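(* Let $\mathcal G\rightrightarrows M$ be a regular Lie groupoid with orbit foliation $\mathcal O$ and normal bundle $N:=TM/T\mathcal O\to M$. The orbitwise normal representations of $\mathcal G$ assemble into a smooth representation $\lambda^N:\mathcal G\times_MN\to N$, $(g,[v_x])\mapsto\lambda^N_g([v_x])$, where $\mathcal G\times_MN=\{(g,n):s(g)=\pi_N(n)\}$, such that the bundle projection $\pi_N:N\to M$ satisfies $\pi_N(\lambda^N(g,[v_x]))=t(g)$. If moreover $M$ is compact and connected and is equipped with a $0$-metric, then each $\lambda^N_g$ is an isometry for the induced metric $g^N$ on $N$.
   Context: A Lie groupoid $\mathcal G\rightrightarrows M$ has a smooth Hausdorff object manifold $M$ and a smooth, possibly non-Hausdorff, arrow manifold $\mathcal G$; the source $s$ is a submersion with Hausdorff fibres; target $t$, units, inversion and multiplication are smooth. The orbit through $x$ is $O_x=t(s^{-1}(x))$. The Lie algebroid is $A_{\mathcal G}=\ker(ds)|_M$ (restricted to units) with anchor $\rho_{\mathcal G}=dt|_{A_{\mathcal G}}$. $\mathcal G$ is regular if $\rho_{\mathcal G}$ has locally constant rank; then $T\mathcal O:=\operatorname{im}\rho_{\mathcal G}$ is an involutive subbundle defining the orbit foliation $\mathcal O$, whose leaves are the connected components of the orbits, and $N_x=\nu_x(O_x)$. For an orbit $O$ and an arrow $g:x\to y$ between points of $O$, the (orbitwise) normal representation is $\lambda_g:\nu_x(O)\to\nu_y(O)$, where $\nu(O)=TM|_O/TO$, $\lambda_g([v])=[dt_g(X)]$ for any $X\in T_g\mathcal G$ with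 $ds_g(X)=v$; it is independent of choices. A $0$-metric is a Riemannian metric on $M$ such that for every orbit $O$ all $\lambda_g$ are isometries for the quotient metric on $\nu(O)$; $g^N$ is the quotient metric on $N$. A representation of $\mathcal G$ on $N$ is an action by linear isomorphisms $N_{s(g)}\to N_{t(g)}$, compatible with units and composition. *)

(* Defs.v *)
From HB Require Import structures.
From mathcomp Require Import all_boot all_order all_algebra.
From mathcomp Require Import all_classical all_reals all_analysis.
Import Order.TTheory GRing.Theory Num.Theory numFieldNormedType.Exports.

Set Implicit Arguments.
Unset Strict Implicit.
Unset Printing Implicit Defensive.

Local Open Scope classical_set_scope.
Local Open Scope ring_scope.

(* [Ck j U f]: f is of class C^j on the open set U.  In finite dimension,
   x |-> 'd f x is C^j iff x |-> 'd f x v is C^j for every v. *)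
Fixpoint Ck (R : realType) (V W : normedModType R) (j : nat)
    (U : set V) (f : V -> W) : Prop :=
  match j with
  | 0%N => forall x, U x -> {for x, continuous f}
  | j'.+1 => (forall x, U x -> differentiable f x) /\
             (forall v, Ck j' U (fun x => 'd f x v))
  end.

Definition Cinf (R : realType) (V W : normedModType R)
  (U : set V) (f : V -> W) : Prop := forall j, Ck j U f.

(* [cmap] and [cinv] are total; only their values on [cdom] and on its image
   matter. *)
Record chart (R : realType) (T : Type) (n : nat) := Chart {
  cdom : set T;
  cmap :> T -> 'rV[R]_n;
  cinv : 'rV[R]_n -> T;
  cmapK : forall x, cdom x -> cinv (cmap x) = x;
  cimg_open : open (cmap @` cdom) }.

Definition cimg R T n (c : @chart R T n) : set 'rV[R]_n := c @` cdom c.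

(* Charts of different dimensions are allowed in one atlas, because the rank of
   a normal bundle is only locally constant. *)
Definition charts (R : realType) (T : Type) := set {n : nat & chart R T n}.

Definition of_dim (R : realType) (T : Type) (n : nat) (A : set (chart R T n)) :
  charts R T := [set existT (chart R T) n c | c in A].

Definition is_atlas (R : realType) (T : Type) (A : charts R T) : Prop :=
  (forall x, exists m (c : chart R T m), A (existT _ m c) /\ cdom c x) /\
  (forall m (c : chart R T m) p (d : chart R T p),
     A (existT _ m c) -> A (existT _ p d) ->
     let U := c @` (cdom c `&` cdom d) in
     open U /\ Cinf U (fun y => d (cinv c y))).

(* f is smooth on the subset D: in charts, f restricted to D extends locally
   to a smooth map.  For D = setT this is ordinary smoothness; for an embedded
   submanifold D it is smoothness for the induced structure. *)
Definition smooth_on (R : realType) (T S : Type) (A : charts R T)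
    (B : charts R S) (D : set T) (f : T -> S) : Prop :=
  forall m (c : chart R T m) p (d : chart R S p) x,
    A (existT _ m c) -> B (existT _ p d) -> D x -> cdom c x -> cdom d (f x) ->
    exists (U : set 'rV[R]_m) (F : 'rV[R]_m -> 'rV[R]_p),
      [/\ open U, U (c x), Cinf U F &
          forall z, cdom c z -> D z -> U (c z) ->
            cdom d (f z) /\ F (c z) = d (f z)].

Section ProductCharts.
Context (R : realType) (T S : Type) (m p : nat).
Context (c : chart R T m) (d : chart R S p).

Let pmap (z : T * S) : 'rV[R]_(m + p) := row_mx (c z.1) (d z.2).
Let pinv (y : 'rV[R]_(m + p)) : T * S :=
  (cinv c (lsubmx y), cinv d (rsubmx y)).
Let pdom : set (T * S) := cdom c `*` cdom d.

Let pmapK z : pdom z -> pinv (pmap z) = z.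
Proof.
case: z => x y [/= cx dy]; rewrite /pinv /pmap /=.
by rewrite row_mxKl row_mxKr !cmapK.
Qed.

Let pimg_open : open (pmap @` pdom).
Proof.
suff -> : pmap @` pdom = (lsubmx @^-1` cimg c) `&` (rsubmx @^-1` cimg d).
  apply: openI; apply: open_comp; rewrite ?/cimg; try exact: cimg_open.
  - move=> y _ B /nbhs_ballP[e /= e0 eB]; apply/nbhs_ballP; exists e => //= z yz.
    by apply: eB; split=> // i j; rewrite !mxE; case: yz => _; exact.
  - move=> y _ B /nbhs_ballP[e /= e0 eB]; apply/nbhs_ballP; exists e => //= z yz.
    by apply: eB; split=> // i j; rewrite !mxE; case: yz => _; exact.
apply/seteqP; split => [_ [z [cz dz] <-]|y [[a ca ay] [b db bY]]].
  by rewrite /pmap; split; rewrite /= ?row_mxKl ?row_mxKr;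
    [exists z.1|exists z.2].
by exists (a, b) => //; rewrite /pmap /= ay bY hsubmxK.
Qed.

Definition prod_chart : chart R (T * S) (m + p) := Chart pmapK pimg_open.

End ProductCharts.

Definition prod_charts (R : realType) (T S : Type)
    (A : charts R T) (B : charts R S) : charts R (T * S) :=
  [set C | exists m (c : chart R T m) p (d : chart R S p),
     [/\ A (existT _ m c), B (existT _ p d) &
         C = existT _ (m + p)%N (prod_chart c d)]].

(* Smooth manifolds of dimension n, not necessarily Hausdorff nor second
   countable. *)
Record manifold (R : realType) (n : nat) := Manifold {
  mcarrier :> topologicalType;
  matlas : set (chart R mcarrier n);
  matlasP : is_atlas (of_dim matlas);
  mchart_homeo : forall c, matlas c ->
    [/\ open (cdom c),
        (forall x, cdom c x -> {for x, continuous (cmap c)}) &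
        (forall y, cimg c y -> {for y, continuous (cinv c)})] }.

Definition mcharts R n (M : @manifold R n) : charts R M := of_dim (@matlas R n M).
Arguments mcharts {R n} M.

Lemma matlas_cover R n (M : @manifold R n) (x : M) :
  exists c, @matlas R n M c /\ cdom c x.
Proof.
have [/(_ x)[m [c [[c' Ac' e] cx]]] _] := @matlasP R n M.
exists c'; split=> //.
have : cdom (projT2 (existT (chart R M) m c)) x by [].
by rewrite -e.
Qed.

Definition chart_at R n (M : @manifold R n) (x : M) : chart R M n :=
  projT1 (cid (matlas_cover x)).

Definition smooth R m n (M : @manifold R m) (N : @manifold R n) (f : M -> N) :=
  smooth_on (mcharts M) (mcharts N) setT f.

(* T_x M is 'rV[R]_n, a tangent vector being given by its components in the
   chart [chart_at x].  Matrices act on row vectors from the right: the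
   differential of f at x is v |-> v *m tmap f x. *)
Definition tmap R m n (M : @manifold R m) (N : @manifold R n) (f : M -> N)
    (x : M) : 'M[R]_(m, n) :=
  'J (chart_at (f x) \o f \o cinv (chart_at x)) (chart_at x x).

(* Components of tangent vectors at x in another chart c, and back. *)
Definition to_chart R n (M : @manifold R n) (c : chart R M n) (x : M) :
  'M[R]_n := 'J (c \o cinv (chart_at x)) (chart_at x x).
Definition from_chart R n (M : @manifold R n) (c : chart R M n) (x : M) :
  'M[R]_n := 'J (chart_at x \o cinv c) (c x).

Record lie_groupoid (R : realType) (n k : nat)
    (M : manifold R n) (G : manifold R k) := LieGroupoid {
  src : G -> M;
  tgt : G -> M;
  gunit : M -> G;
  ginv : G -> G;
  gmul : G -> G -> G;  (* relevant only on composable pairs: src g = tgt h *)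
  src_unit : forall x, src (gunit x) = x;
  tgt_unit : forall x, tgt (gunit x) = x;
  src_inv : forall g, src (ginv g) = tgt g;
  tgt_inv : forall g, tgt (ginv g) = src g;
  src_mul : forall g h, src g = tgt h -> src (gmul g h) = src h;
  tgt_mul : forall g h, src g = tgt h -> tgt (gmul g h) = tgt g;
  gmulA : forall g h l, src g = tgt h -> src h = tgt l ->
    gmul g (gmul h l) = gmul (gmul g h) l;
  gmul1g : forall g, gmul (gunit (tgt g)) g = g;
  gmulg1 : forall g, gmul g (gunit (src g)) = g;
  gmulVg : forall g, gmul (ginv g) g = gunit (src g);
  gmulgV : forall g, gmul g (ginv g) = gunit (tgt g);
  base_hausdorff : hausdorff_space M;
  src_fibre_hausdorff : forall x, hausdorff_space (subspace (src @^-1` [set x]));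
  src_smooth : smooth src;
  src_submersion : forall g, row_full (tmap src g);
  tgt_smooth : smooth tgt;
  unit_smooth : smooth gunit;
  inv_smooth : smooth ginv;
  mul_smooth : smooth_on (prod_charts (mcharts G) (mcharts G)) (mcharts G)
    [set p | src p.1 = tgt p.2] (fun p => gmul p.1 p.2) }.

(* The class [v] = v + W in the quotient of 'rV[R]_n by the subspace W. *)
Definition coset (R : realType) (n : nat) (W : set 'rV[R]_n) (v : 'rV[R]_n) :
  set 'rV[R]_n := [set u | W (u - v)].

Section QuotientBundle.
Context (R : realType) (n : nat) (M : manifold R n).
Context (W : M -> set 'rV[R]_n).

(* Total space of TM / W. *)
Record quot_bundle := QuotPoint {
  qbase : M;
  qclass : set 'rV[R]_n;
  qclassP : exists v, qclass = coset (W qbase) v }.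

Definition qpt (x : M) (v : 'rV[R]_n) : quot_bundle :=
  @QuotPoint x (coset (W x) v) (ex_intro _ v erefl).

(* The rows of e are smooth vector fields on U (contained in the domain of c)
   whose classes form a basis of T_xM / W_x at every point x of U. *)
Definition quot_frame q (c : chart R M n) (U : set M) (e : M -> 'M[R]_(q, n)) :=
  Cinf (c @` U) (fun y => e (cinv c y) *m to_chart c (cinv c y)) /\
  (forall x, U x -> forall v, exists! a : 'rV[R]_q, W x (v - a *m e x)).

(* The charts (x, [\sum_i a_i e_i]) |-> (c x, a) given by local frames. *)
Definition quot_charts : charts R quot_bundle :=
  [set C | exists q (c : chart R M n) (U : set M) (e : M -> 'M[R]_(q, n))
      (D : chart R quot_bundle (n + q)),
    [/\ matlas c, open U /\ U `<=` cdom c, quot_frame c U e,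
        cdom D = qbase @^-1` U /\
        (forall z, U (qbase z) ->
           lsubmx (D z) = c (qbase z) /\
           qclass z = coset (W (qbase z)) (rsubmx (D z) *m e (qbase z))) &
        C = existT _ (n + q)%N D]].

End QuotientBundle.
Arguments quot_charts {R n M} W.

(* The inner product v, w |-> v H w^T. *)
Definition inner (R : realType) (n : nat) (H : 'M[R]_n) (v w : 'rV[R]_n) : R :=
  (v *m H *m w^T) 0 0.

(* The representative of the class C that is H-orthogonal to W. *)
Definition horizontal (R : realType) (n : nat) (H : 'M[R]_n)
    (W C : set 'rV[R]_n) : 'rV[R]_n :=
  xget 0 [set v | C v /\ forall w, W w -> inner H v w = 0].

(* Quotient inner product, from the identification of V / W with the
   orthogonal complement of W. *)
Definition quot_inner (R : realType) (n : nat) (H : 'M[R]_n)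
    (W C D : set 'rV[R]_n) : R :=
  inner H (horizontal H W C) (horizontal H W D).

(* H x is the Gram matrix of the metric on T_x M. *)
Definition riemannian_metric R n (M : @manifold R n) (H : M -> 'M[R]_n) : Prop :=
  [/\ forall x, (H x)^T = H x,
      forall x v, v != 0 -> 0 < inner (H x) v v &
      forall c, matlas c ->
        Cinf (cimg c) (fun y => let x := cinv c y in
          from_chart c x *m H x *m (from_chart c x)^T)].

Section LieGroupoidNotions.
Context (R : realType) (n k : nat) (M : manifold R n) (G : manifold R k).
Context (GG : lie_groupoid M G).

Definition gorbit (x : M) : set M := tgt GG @` (src GG @^-1` [set x]).

(* T_y O for the orbit O of x, whose smooth structure makes
   t : s^-1(x) -> O a submersion. *)
Definition orbit_tangent (x y : M) : set 'rV[R]_n :=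
  [set u | exists (g : G) (X : 'rV[R]_k),
     [/\ src GG g = x, tgt GG g = y, X *m tmap (src GG) g = 0 &
         u = X *m tmap (tgt GG) g]].

(* The anchor at x, precomposed with a projection of T_{1_x}G onto the fibre
   ker ds of the Lie algebroid: its row space is the image of the anchor. *)
Definition anchor (x : M) : 'M[R]_(k, n) :=
  kermx (tmap (src GG) (gunit GG x)) *m tmap (tgt GG) (gunit GG x).

Definition regular : Prop :=
  forall x : M, \forall y \near x, \rank (anchor y) = \rank (anchor x).

Definition im_anchor (x : M) : set 'rV[R]_n := [set v | (v <= anchor x)%MS].

Definition normal_bundle := quot_bundle im_anchor.

(* lambda_g : nu_{s g}(O) -> nu_{t g}(O) for the orbit O of x, on classes. *)
Definition orbit_normal_rep (x : M) (g : G) (C : set 'rV[R]_n) : set 'rV[R]_n :=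
  [set u | exists2 X : 'rV[R]_k, C (X *m tmap (src GG) g) &
     coset (orbit_tangent x (tgt GG g)) (X *m tmap (tgt GG) g) u].

Definition zero_metric (H : M -> 'M[R]_n) : Prop :=
  riemannian_metric H /\
  forall x (g : G), gorbit x (src GG g) -> gorbit x (tgt GG g) ->
    let y := src GG g in let z := tgt GG g in
    forall v w : 'rV[R]_n,
      quot_inner (H z) (orbit_tangent x z)
        (orbit_normal_rep x g (coset (orbit_tangent x y) v))
        (orbit_normal_rep x g (coset (orbit_tangent x y) w)) =
      quot_inner (H y) (orbit_tangent x y)
        (coset (orbit_tangent x y) v) (coset (orbit_tangent x y) w).

(* G x_M E for the quotient bundle E *)
Definition action_dom (W : M -> set 'rV[R]_n) : set (G * quot_bundle W) :=
  [set p | src GG p.1 = qbase p.2].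

(* [lam g e] is relevant only when e lies over src g. *)
Definition representation (W : M -> set 'rV[R]_n)
    (lam : G -> quot_bundle W -> quot_bundle W) : Prop :=
  [/\ forall g, set_bij (@qbase _ _ _ W @^-1` [set src GG g])
                        (@qbase _ _ _ W @^-1` [set tgt GG g]) (lam g),
      forall g (a : R) (u v u' v' : 'rV[R]_n),
        lam g (qpt W (src GG g) u) = qpt W (tgt GG g) u' ->
        lam g (qpt W (src GG g) v) = qpt W (tgt GG g) v' ->
        lam g (qpt W (src GG g) (a *: u + v)) = qpt W (tgt GG g) (a *: u' + v'),
      forall e, lam (gunit GG (qbase e)) e = e &
      forall g h e, src GG g = tgt GG h -> src GG h = qbase e ->
        lam (gmul GG g h) e = lam g (lam h e)].

Definition smooth_representation (W : M -> set 'rV[R]_n)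
    (lam : G -> quot_bundle W -> quot_bundle W) : Prop :=
  representation lam /\
  smooth_on (prod_charts (mcharts G) (quot_charts W)) (quot_charts W)
    (@action_dom W) (fun p => lam p.1 p.2).

End LieGroupoidNotions.

(* The metric induced by H on the quotient bundle; e and e' must lie over the
   same point. *)
Definition quot_metric R n (M : @manifold R n) (W : M -> set 'rV[R]_n)
    (H : M -> 'M[R]_n) (e e' : quot_bundle W) : R :=
  quot_inner (H (qbase e)) (W (qbase e)) (qclass e) (qclass e').

(* Main.v *)
From HB Require Import structures.
Require Import Defs.
From mathcomp Require Import all_boot all_order all_algebra.
From mathcomp Require Import all_classical all_reals all_analysis.
From mathcomp Require Import ring lra.
Import Order.TTheory GRing.Theory Num.Def Num.Theory numFieldNormedType.Exports.
Local Open Scope classical_set_scope.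
Local Open Scope ring_scope.
Set Implicit Arguments.
Unset Strict Implicit.
Unset Printing Implicit Defensive.

(** The representation lifts a normal vector v at s g to some X in T_g G with
    ds X = v, and takes the class of dt X.  What makes this work is one property
    of the partial multiplication, [mul_tangent]: if s g = t h and ds X = dt Y,
    there is Z tangent to G at g h with ds Z = ds Y and dt Z = dt X.  Applied
    with h the inverse of g, or with g a unit, it identifies the tangent spaces
    of the orbits with the image of the anchor ([orbit_tangentE]); with h a unit,
    it shows that the class of dt X depends only on the class of ds X
    ([src_tangent_anchor]); for general g and h, it is the functoriality of the
    representation ([normal_rep_mul]).

    The vector Z is the derivative, in the direction (X, Y), of a local smooth
    extension F of the multiplication.  Nothing is known about F away from
    composable pairs, so t (g h) = t g and s (g h) = s h may only be
    differentiated along vectors tangent to the set of composable pairs.  That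
    set is the zero set of a submersion whose derivative kills (X, Y), and
    [vanish_kernel] says that a function vanishing on such a zero set has zero
    derivative along that kernel.  This is the part of the implicit function
    theorem that the proof needs: near a + tau v there is a zero of the
    constraint at distance o(tau).

    For smoothness, regularity makes the image W of the anchor a smooth
    subbundle ([anchor_frame]): in charts it is the row space of a smooth matrix
    of constant rank.  A frame of W and a frame of the quotient together form a
    smooth matrix with linearly independent rows that span, so that the
    coordinates of a class in the frame of the quotient depend smoothly on the
    base point ([frame_coord]).  Both the transition maps of the bundle charts
    and the representation are then, on coordinate rows, multiplication by a
    product of smooth matrices.

    The representation is isometric because the 0-metric condition is a
    condition on orbits, and the quotient inner products by T O and by the image
    of the anchor are the same once these subspaces agree. *)

(** * Smooth maps between normed spaces *)

Lemma near_eq_diff (R : realType) (V W : normedModType R) (f g : V -> W) x :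
  (\forall y \near x, f y = g y) -> differentiable f x ->
  differentiable g x /\ forall v, 'd g x v = 'd f x v.
Proof.
move=> fg df.
have fgx : f x = g x by exact: nbhs_singleton fg.
have dg : g \o shift x = cst (g x) + 'd f x +o_ 0 id.
  apply/eqaddoP => e e0.
  have /eqaddoP/(_ _ e0) := diff_locally df.
  have : \forall h \near (0 : V), f (h + x) = g (h + x).
    by move: fg; rewrite (near_shift 0 x); apply: filterS => h; rewrite /= subr0.
  by apply: filterS2 => h /= fgh; rewrite !fctE /= fgh fgx.
have dgE : 'd g x = 'd f x :> (V -> W).
  by apply: diff_unique => //; exact: diff_continuous.
split; last by move=> v; rewrite dgE.
by apply/diff_locallyP; rewrite dgE; split => //; exact: diff_continuous.
Qed.

(** A named entry map, so that it can carry a linear structure. *)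
Definition mxcoord (R : realType) m n i j (A : 'M[R]_(m, n)) : R := A i j.

Lemma mxcoord_is_linear (R : realType) m n i j : linear (@mxcoord R m n i j).
Proof. by move=> a A B; rewrite /mxcoord !mxE. Qed.

HB.instance Definition _ (R : realType) m n i j :=
  GRing.isLinear.Build R 'M[R]_(m, n) R _ (@mxcoord R m n i j)
    (@mxcoord_is_linear R m n i j).

Section CkTheory.
Context (R : realType).
Implicit Types V W : normedModType R.

Lemma Ck_sub V W j (U U' : set V) (f : V -> W) :
  U' `<=` U -> Ck j U f -> Ck j U' f.
Proof.
move=> UU'; elim: j f => [|j IH] f /=; first by move=> h x /UU'; exact: h.
by case=> h1 h2; split=> [x /UU'|v]; [exact: h1|exact: IH].
Qed.

Lemma Ck_eq V W j (U : set V) (f g : V -> W) :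
  open U -> (forall x, U x -> f x = g x) -> Ck j U f -> Ck j U g.
Proof.
move=> oU; elim: j f g => [|j IH] f g fg.
  move=> /= h x Ux; have := h x Ux; rewrite /prop_for /continuous_at -fg //.
  apply: cvg_trans; apply: near_eq_cvg.
  by near=> y; apply: fg; near: y; exact: open_nbhs_nbhs.
case=> h1 h2.
have nfg x : U x -> \forall y \near x, f y = g y.
  by move=> Ux; near=> y; apply: fg; near: y; exact: open_nbhs_nbhs.
split=> [x Ux|v]; first by have [] := near_eq_diff (nfg x Ux) (h1 x Ux).
apply: IH (h2 v) => x Ux.
by have [_ ->] := near_eq_diff (nfg x Ux) (h1 x Ux).
Unshelve. all: by end_near. Qed.

Lemma Ck_le V W j (U : set V) (f : V -> W) : Ck j.+1 U f -> Ck j U f.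
Proof.
elim: j f => [|j IH] f [h1 h2].
  by move=> x /h1; exact: differentiable_continuous.
by split=> // v; apply: IH.
Qed.

Lemma Ck_cst V W j (U : set V) (w : W) : Ck j U (fun=> w).
Proof.
elim: j w => [|j IH] w; first by move=> x _; exact: cvg_cst.
split=> [x _|v]; first exact: differentiable_cst.
have -> : (fun x : V => 'd (fun=> w) x v) = fun=> 0.
  by apply/funext => x; rewrite diff_cst.
exact: IH.
Qed.

Lemma Ck_lin V W j (U : set V) (f : {linear V -> W}) : continuous f -> Ck j U f.
Proof.
case: j => [|j] fc; first by move=> x _; exact: fc.
split=> [x _|v]; first exact: linear_differentiable.
have -> : (fun x : V => 'd f x v) = fun=> f v.
  by apply/funext => x; rewrite diff_lin.
exact: Ck_cst.
Qed.

Lemma Ck_linr V W W' j (U : set V) (f : V -> W) (L : {linear W -> W'}) :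
  open U -> continuous L -> Ck j U f -> Ck j U (fun x => L (f x)).
Proof.
move=> oU Lc; elim: j f => [|j IH] f.
  by move=> h x Ux; apply: continuous_comp; [exact: h|exact: Lc].
have Ld y := linear_differentiable y Lc.
case=> f1 f2; split=> [x Ux|v].
  by apply: differentiable_comp; [exact: f1|].
apply: (Ck_eq oU _ (IH _ (f2 v))) => x Ux.
by rewrite (diff_comp (f1 x Ux) (Ld _)) diff_lin.
Qed.

Lemma CkD V W j (U : set V) (f g : V -> W) : open U ->
  Ck j U f -> Ck j U g -> Ck j U (fun x => f x + g x).
Proof.
move=> oU; elim: j f g => [|j IH] f g.
  by move=> h1 h2 x Ux; apply: cvgD; [exact: h1|exact: h2].
case=> f1 f2 [g1 g2]; split=> [x Ux|v].
  by apply: differentiableD; [exact: f1|exact: g1].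
apply: (Ck_eq oU _ (IH _ _ (f2 v) (g2 v))) => x Ux.
have -> : (fun x => f x + g x) = f + g by [].
by rewrite diffD //; [exact: f1|exact: g1].
Qed.

(** The product rule, from the derivative of the bounded bilinear scaling map. *)
Lemma diff_scale V W (a : V -> R) (f : V -> W) x v :
  differentiable a x -> differentiable f x ->
  differentiable (fun y => a y *: f y) x /\
  'd (fun y => a y *: f y) x v = 'd a x v *: f x + a x *: 'd f x v.
Proof.
move=> da df.
have Bbil : bilinear_for (GRing.Scale.Law.clone _ _ *:%R _)
    (GRing.Scale.Law.clone _ _ *:%R _) (@GRing.scale R W : R -> W -> W).
  by split=> [w|b] c y z /=;
    rewrite ?scalerDl ?scalerDr ?scalerA //; congr (_ *: _ + _); rewrite mulrC.
pose B : {bilinear R -> W -> W} :=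
  HB.pack (@GRing.scale R W : R -> W -> W)
    (bilinear_isBilinear.Build R R W W _ _ _ Bbil).
have Bc : continuous (fun p : R * W => B p.1 p.2).
  by move=> p; exact: scale_continuous.
have dB p : differentiable (fun p : R * W => B p.1 p.2) p.
  exact: differentiable_bilin.
have dp := differentiable_pair da df.
split; first exact: (@differentiable_comp _ _ _ _ _ (fun p => B p.1 p.2) x dp).
have -> : (fun y => a y *: f y) = (fun p => B p.1 p.2) \o (fun y => (a y, f y)).
  by [].
by rewrite diff_comp // diff_bilin // diff_pair //= addrC.
Qed.

Lemma CkZ V W j (U : set V) (a : V -> R) (f : V -> W) : open U ->
  Ck j U a -> Ck j U f -> Ck j U (fun x => a x *: f x).
Proof.
move=> oU; elim: j a f => [|j IH] a f.
  by move=> h1 h2 x Ux; apply: cvgZ; [exact: h1|exact: h2].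
move=> Ca Cf; have [a1 a2] := Ca; have [f1 f2] := Cf.
split=> [x Ux|v].
  by have [] := diff_scale 0 (a1 x Ux) (f1 x Ux).
have CaZ := IH _ _ (a2 v) (Ck_le Cf).
have CfZ := IH _ _ (Ck_le Ca) (f2 v).
apply: (Ck_eq oU _ (CkD oU CaZ CfZ)) => x Ux.
by have [_ ->] := diff_scale v (a1 x Ux) (f1 x Ux).
Qed.

Lemma Ck_sum V W j (U : set V) (I : Type) (r : seq I) (P : pred I)
    (f : I -> V -> W) : open U ->
  (forall i, P i -> Ck j U (f i)) -> Ck j U (fun x => \sum_(i <- r | P i) f i x).
Proof.
move=> oU h; elim: r => [|i r IH].
  have -> : (fun x => \sum_(i <- [::] | P i) f i x) = fun=> 0.
    by apply/funext => x; rewrite big_nil.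
  exact: Ck_cst.
have [Pi|Pi] := boolP (P i).
  apply: (Ck_eq oU _ (CkD oU (h i Pi) IH)) => x _ /=.
  by rewrite big_cons Pi.
by apply: (Ck_eq oU _ IH) => x _; rewrite big_cons (negbTE Pi).
Qed.

(** The derivative of a composite in the direction v is the sum of the partial
    derivatives of g along f, weighted by the components of the derivative of f:
    a sum of products of maps of one class lower, to which induction applies. *)
Lemma Ck_comp m V W j (U : set V) (U' : set 'rV[R]_m) (f : V -> 'rV[R]_m)
    (g : 'rV[R]_m -> W) : open U -> open U' -> (forall x, U x -> U' (f x)) ->
  Ck j U f -> Ck j U' g -> Ck j U (fun x => g (f x)).
Proof.
move=> oU oU' UU'; elim: j W g => [|j IH] W g.
  by move=> h1 h2 x Ux; apply: continuous_comp; [exact: h1|exact/h2/UU'].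
move=> Cf [g1 g2]; have [f1 f2] := Cf.
split=> [x Ux|v].
  by apply: differentiable_comp; [exact: f1|exact/g1/UU'].
pose F x := \sum_(i < m) 'd f x v 0 i *: 'd g (f x) (delta_mx 0 i).
apply: (@Ck_eq _ _ _ U F) => // [x Ux|].
  rewrite (diff_comp (f1 x Ux) (g1 _ (UU' _ Ux))) /= /F.
  rewrite [in RHS](row_sum_delta ('d f x v)) linear_sum.
  by apply: eq_bigr => i _; rewrite linearZ.
apply: Ck_sum => // i _; apply: CkZ => //; last exact: IH (Ck_le Cf) (g2 _).
exact: (Ck_linr (L := mxcoord 0 i)) (@coord_continuous _ _ _ 0 i) (f2 v).
Qed.

Lemma CkV V j (U : set V) (a : V -> R) : open U -> (forall x, U x -> a x != 0) ->
  Ck j U a -> Ck j U (fun x => (a x)^-1).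
Proof.
move=> oU a0; elim: j => [|j IH].
  by move=> h x Ux; apply: cvgV; [exact: a0|exact: h].
move=> Ca; have [a1 a2] := Ca; have IHa := IH (Ck_le Ca).
split=> [x Ux|v]; first by apply: differentiableV; [exact: a1|exact: a0].
have aD := CkZ oU (CkZ oU IHa IHa) (CkZ oU (@Ck_cst V R j U (-1)) (a2 v)).
apply: (Ck_eq oU _ aD) => x Ux.
have dV := congr1 (fun h => h v) (diffV (a1 x Ux) (a0 x Ux)).
transitivity (- (a x) ^- 2 *: 'd a x v); last exact: esym dV.
by rewrite !scalerA mulrN1 -exprVn.
Qed.

End CkTheory.

(** Smoothness of the germ at a point: it is stable under composition and
    inversion without having to name domains. *)
Definition smooth_at (R : realType) (V W : normedModType R) (f : V -> W) (x : V) :=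
  exists U : set V, [/\ open U, U x & Cinf U f].

Section SmoothAt.
Context (R : realType).
Implicit Types V W : normedModType R.

Lemma smooth_at_eq V W (f g : V -> W) x :
  (\forall y \near x, f y = g y) -> smooth_at f x -> smooth_at g x.
Proof.
rewrite /prop_near1 nbhsE => -[U' [oU' U'x] fg] [U [oU Ux Cf]].
have oI : open (U `&` U') by exact: openI.
exists (U `&` U'); split=> // j; apply: (Ck_eq oI _ (Ck_sub _ (Cf j))).
  by move=> y [_ /fg].
exact: subIsetl.
Qed.

Lemma smooth_at_ext V W (f g : V -> W) x :
  f =1 g -> smooth_at f x -> smooth_at g x.
Proof. by move/funext=> ->. Qed.

Lemma Cinf_smooth_at V W (U : set V) (f : V -> W) x :
  open U -> U x -> Cinf U f -> smooth_at f x.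
Proof. by exists U. Qed.

Lemma smooth_at_Cinf V W (U : set V) (f : V -> W) :
  (forall x, U x -> smooth_at f x) -> Cinf U f.
Proof.
move=> h j; elim: j f h => [|j IH] f h.
  by move=> x /h[U' [oU' U'x Cf]]; exact: (Cf 0%N x U'x).
split=> [x /h[U' [oU' U'x Cf]]|v]; first by have [d1 _] := Cf 1%N; exact: d1.
apply: IH => x /h[U' [oU' U'x Cf]]; exists U'; split=> // i.
by have [_ d2] := Cf i.+1; exact: d2.
Qed.

Lemma smooth_at_near V W (f : V -> W) x :
  smooth_at f x -> \forall y \near x, smooth_at f y.
Proof.
by case=> U [oU Ux Cf]; near=> y; exists U; split=> //; near: y; exact: open_nbhs_nbhs.
Unshelve. all: by end_near. Qed.

Lemma smooth_at_differentiable V W (f : V -> W) x :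
  smooth_at f x -> differentiable f x.
Proof. by case=> U [_ Ux Cf]; have [d1 _] := Cf 1%N; exact: d1. Qed.

Lemma smooth_at_continuous V W (f : V -> W) x :
  smooth_at f x -> {for x, continuous f}.
Proof. by move/smooth_at_differentiable/differentiable_continuous. Qed.

Lemma smooth_at_diff V W (f : V -> W) x v :
  smooth_at f x -> smooth_at (fun y => 'd f y v) x.
Proof. by case=> U [oU Ux Cf]; exists U; split=> // j; have [_ d2] := Cf j.+1; exact: d2. Qed.

Lemma smooth_at_cst V W (w : W) (x : V) : smooth_at (fun=> w) x.
Proof. by exists setT; split=> // [|j]; [exact: openT|exact: Ck_cst]. Qed.

Lemma smooth_at_id V (x : V) : smooth_at id x.
Proof.
exists setT; split=> // [|j]; [exact: openT|].
by apply: (@Ck_lin R V V j setT idfun) => y; exact: cvg_id.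
Qed.

Lemma smooth_at_lin V W W' (L : {linear W -> W'}) (f : V -> W) x :
  continuous L -> smooth_at f x -> smooth_at (fun y => L (f y)) x.
Proof. by move=> Lc [U [oU Ux Cf]]; exists U; split=> // j; apply: Ck_linr. Qed.

(** Two germs are restricted to a common domain, where closure properties of
    maps of class C^j on an open set apply. *)
Lemma smooth_at2 V W W' W'' (f : V -> W) (g : V -> W') (h : V -> W'') x :
  (forall U j, open U -> Ck j U f -> Ck j U g -> Ck j U h) ->
  smooth_at f x -> smooth_at g x -> smooth_at h x.
Proof.
move=> H [U [oU Ux Cf]] [U' [oU' U'x Cg]].
exists (U `&` U'); split=> // [|j]; first exact: openI.
apply: H; first exact: openI.
- by apply: Ck_sub (Cf j); exact: subIsetl.
- by apply: Ck_sub (Cg j); exact: subIsetr.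
Qed.

Lemma smooth_atD V W (f g : V -> W) x :
  smooth_at f x -> smooth_at g x -> smooth_at (fun y => f y + g y) x.
Proof. by apply: smooth_at2 => U j; exact: CkD. Qed.

Lemma smooth_atZ V W (a : V -> R) (f : V -> W) x :
  smooth_at a x -> smooth_at f x -> smooth_at (fun y => a y *: f y) x.
Proof. by apply: smooth_at2 => U j; exact: CkZ. Qed.

Lemma smooth_atN V W (f : V -> W) x :
  smooth_at f x -> smooth_at (fun y => - f y) x.
Proof.
move=> /(smooth_atZ (smooth_at_cst (-1 : R) x)); apply: smooth_at_ext.
by move=> y; rewrite scaleN1r.
Qed.

Lemma smooth_atB V W (f g : V -> W) x :
  smooth_at f x -> smooth_at g x -> smooth_at (fun y => f y - g y) x.
Proof. by move=> sf /smooth_atN; exact: smooth_atD. Qed.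

Lemma smooth_atM V (a b : V -> R) x :
  smooth_at a x -> smooth_at b x -> smooth_at (fun y => a y * b y) x.
Proof. exact: smooth_atZ. Qed.

Lemma smooth_at_sum V W (I : Type) (r : seq I) (P : pred I) (f : I -> V -> W) x :
  (forall i, P i -> smooth_at (f i) x) ->
  smooth_at (fun y => \sum_(i <- r | P i) f i y) x.
Proof.
move=> sf; elim: r => [|i r IH].
  by apply: smooth_at_ext (@smooth_at_cst V W 0 x) => y; rewrite big_nil.
have [Pi|Pi] := boolP (P i).
  apply: smooth_at_ext (smooth_atD (sf i Pi) IH) => y.
  by rewrite big_cons Pi.
by apply: smooth_at_ext IH => y; rewrite big_cons (negbTE Pi).
Qed.

Lemma smooth_at_prod V (I : Type) (r : seq I) (P : pred I) (f : I -> V -> R) x :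
  (forall i, P i -> smooth_at (f i) x) ->
  smooth_at (fun y => \prod_(i <- r | P i) f i y) x.
Proof.
move=> sf; elim: r => [|i r IH].
  by apply: smooth_at_ext (@smooth_at_cst V R 1 x) => y; rewrite big_nil.
have [Pi|Pi] := boolP (P i).
  apply: smooth_at_ext (smooth_atM (sf i Pi) IH) => y.
  by rewrite big_cons Pi.
by apply: smooth_at_ext IH => y; rewrite big_cons (negbTE Pi).
Qed.

Lemma near_neq0 (b : R) : b != 0 -> nbhs b [set z | z != 0].
Proof.
move=> b0; apply: open_nbhs_nbhs; split=> //; exact: open_neq.
Qed.

Lemma smooth_atV V (a : V -> R) x :
  a x != 0 -> smooth_at a x -> smooth_at (fun y => (a y)^-1) x.
Proof.
move=> ax0 sa; have [U [oU Ux Ca]] := sa.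
have : \forall y \near x, a y != 0.
  exact: (smooth_at_continuous sa) (near_neq0 ax0).
rewrite /prop_near1 nbhsE => -[U' [oU' U'x] a0].
have oI : open (U `&` U') by exact: openI.
exists (U `&` U'); split=> // j; apply: CkV => //; first by move=> y [_ /a0].
by apply: Ck_sub (Ca j); exact: subIsetl.
Qed.

Lemma smooth_at_comp m V W (f : V -> 'rV[R]_m) (g : 'rV[R]_m -> W) x :
  smooth_at f x -> smooth_at g (f x) -> smooth_at (fun y => g (f y)) x.
Proof.
move=> sf [U' [oU' U'x Cg]]; have [U [oU Ux Cf]] := sf.
have : \forall y \near x, U' (f y).
  by apply: ((smooth_at_continuous sf) U'); exact: open_nbhs_nbhs.
rewrite /prop_near1 nbhsE => -[U2 [oU2 U2x] fU'].
have oI : open (U `&` U2) by exact: openI.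
exists (U `&` U2); split=> // j; apply: (Ck_comp oI oU' _ _ (Cg j)).
  by move=> y [_ /fU'].
by apply: Ck_sub (Cf j); exact: subIsetl.
Qed.

Lemma smooth_at_mx V m n (F : V -> 'M[R]_(m, n)) x :
  (forall i j, smooth_at (fun y => F y i j) x) -> smooth_at F x.
Proof.
move=> h; apply: (@smooth_at_ext _ _
  (fun x => \sum_(i < m) \sum_(k < n) F x i k *: delta_mx i k)).
  by move=> y; rewrite -matrix_sum_delta.
do 2 (apply: smooth_at_sum => ? _).
by apply: smooth_atZ => //; exact: smooth_at_cst.
Qed.

Lemma smooth_at_coord V m n (F : V -> 'M[R]_(m, n)) x i j :
  smooth_at F x -> smooth_at (fun y => F y i j) x.
Proof. exact: (@smooth_at_lin _ _ _ (mxcoord i j)) (@coord_continuous _ _ _ i j). Qed.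

Lemma smooth_at_mulmx V m n p (F : V -> 'M[R]_(m, n)) (H : V -> 'M[R]_(n, p)) x :
  smooth_at F x -> smooth_at H x -> smooth_at (fun y => F y *m H y) x.
Proof.
move=> sF sH; apply: smooth_at_mx => i j.
apply: (@smooth_at_ext _ _ (fun y => \sum_k F y i k * H y k j)).
  by move=> y; rewrite mxE.
by apply: smooth_at_sum => k _; apply: smooth_atM; exact: smooth_at_coord.
Qed.

Lemma smooth_at_det V n (F : V -> 'M[R]_n) x :
  smooth_at F x -> smooth_at (fun y => \det (F y)) x.
Proof.
move=> sF; apply: smooth_at_sum => s _; apply: smooth_atM.
  exact: smooth_at_cst.
by apply: smooth_at_prod => i _; exact: smooth_at_coord.
Qed.

Lemma unitmx_near V n (F : V -> 'M[R]_n) x : smooth_at F x ->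
  F x \in unitmx -> \forall y \near x, F y \in unitmx.
Proof.
move=> sF uF; have sd := smooth_at_det sF.
have d0 : \det (F x) != 0 by rewrite -unitfE.
have nu : \forall y \near x, \det (F y) != 0.
  exact: (smooth_at_continuous sd) (near_neq0 d0).
by apply: filterS nu => y dy; rewrite unitmxE unitfE.
Qed.

(** By Cramer's rule the inverse is a rational function of the entries. *)
Lemma smooth_at_invmx V n (F : V -> 'M[R]_n) x :
  F x \in unitmx -> smooth_at F x -> smooth_at (fun y => invmx (F y)) x.
Proof.
move=> uF sF; have sd := smooth_at_det sF.
have d0 : \det (F x) != 0 by rewrite -unitfE.
apply: (@smooth_at_eq _ _ (fun y => (\det (F y))^-1 *: \adj (F y))).
  by apply: filterS (unitmx_near sF uF) => y uy; rewrite /invmx uy.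
apply: smooth_atZ; first exact: smooth_atV.
apply: smooth_at_mx => i j.
apply: (@smooth_at_ext _ _ (fun y =>
    (-1) ^+ (j + i) * \det (row' j (col' i (F y))))).
  by move=> y; rewrite mxE.
apply: smooth_atM; first exact: smooth_at_cst.
apply: smooth_at_det; apply: smooth_at_mx => a b.
apply: (@smooth_at_ext _ _ (fun y => F y (lift j a) (lift i b))).
  by move=> y; rewrite !mxE.
exact: smooth_at_coord.
Qed.

Lemma smooth_at_row_mx V m n p (F : V -> 'M[R]_(m, n)) (H : V -> 'M[R]_(m, p)) x :
  smooth_at F x -> smooth_at H x -> smooth_at (fun y => row_mx (F y) (H y)) x.
Proof.
move=> sF sH; apply: smooth_at_mx => i j.
case: (split_ordP j) => k ->.
  by apply: smooth_at_ext (smooth_at_coord i k sF) => y; rewrite row_mxEl.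
by apply: smooth_at_ext (smooth_at_coord i k sH) => y; rewrite row_mxEr.
Qed.

Lemma smooth_at_col_mx V m n p (F : V -> 'M[R]_(m, n)) (H : V -> 'M[R]_(p, n)) x :
  smooth_at F x -> smooth_at H x -> smooth_at (fun y => col_mx (F y) (H y)) x.
Proof.
move=> sF sH; apply: smooth_at_mx => i j.
case: (split_ordP i) => k ->.
  by apply: smooth_at_ext (smooth_at_coord k j sF) => y; rewrite col_mxEu.
by apply: smooth_at_ext (smooth_at_coord k j sH) => y; rewrite col_mxEd.
Qed.

Lemma smooth_at_lsubmx V m n p (F : V -> 'M[R]_(m, n + p)) x :
  smooth_at F x -> smooth_at (fun y => lsubmx (F y)) x.
Proof.
move=> sF; apply: smooth_at_mx => i j.
by apply: smooth_at_ext (smooth_at_coord i (lshift p j) sF) => y; rewrite mxE.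
Qed.

Lemma smooth_at_rsubmx V m n p (F : V -> 'M[R]_(m, n + p)) x :
  smooth_at F x -> smooth_at (fun y => rsubmx (F y)) x.
Proof.
move=> sF; apply: smooth_at_mx => i j.
by apply: smooth_at_ext (smooth_at_coord i (rshift n j) sF) => y; rewrite mxE.
Qed.

Lemma smooth_at_jacobian m n (f : 'rV[R]_m -> 'rV[R]_n) x :
  smooth_at f x -> smooth_at (fun y => 'J f y) x.
Proof.
move=> sf; apply: smooth_at_mx => i j.
apply: smooth_at_ext (smooth_at_coord 0 j (smooth_at_diff (delta_mx 0 i) sf)).
by move=> y; rewrite mxE /lin1_mx.
Qed.

Lemma diffJ m n (f : 'rV[R]_m -> 'rV[R]_n) x v : 'd f x v = v *m 'J f x.
Proof. by rewrite mul_rV_lin1. Qed.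

Lemma jacobian_comp m n p (f : 'rV[R]_m -> 'rV[R]_n) (g : 'rV[R]_n -> 'rV[R]_p) x :
  differentiable f x -> differentiable g (f x) ->
  'J (g \o f) x = 'J f x *m 'J g (f x).
Proof.
move=> df dg; apply/row_matrixP => i; rewrite !rowE mulmxA -!diffJ.
by rewrite (diff_comp df dg).
Qed.

Lemma mulmx_ext m n (A B : 'M[R]_(m, n)) :
  (forall v : 'rV[R]_m, v *m A = v *m B) -> A = B.
Proof. by move=> AB; apply/row_matrixP => i; rewrite !rowE AB. Qed.

Lemma jacobian_near m n (f g : 'rV[R]_m -> 'rV[R]_n) x :
  (\forall y \near x, f y = g y) -> differentiable f x -> 'J f x = 'J g x.
Proof.
move=> fg df; have [_ e] := near_eq_diff fg df.
apply: mulmx_ext => v.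
exact: etrans (esym (diffJ f x v)) (etrans (esym (e v)) (diffJ g x v)).
Qed.

End SmoothAt.

(* Differentials and chosen charts are used only through their properties;
   unfolding them makes the comparison of two Jacobians explode. *)
Local Opaque diff jacobian chart_at.

(** * Functions vanishing on the zero set of a submersion *)

Section ConstrainedCriticalPoints.
Context (R : realType).

Lemma mx_entry_le_norm m n (M : 'M[R]_(m, n)) i j : `|M i j| <= `|M|.
Proof.
rewrite [leRHS]/normr /= mx_normrE.
exact: (le_bigmax _ (fun ij => `|M ij.1 ij.2|) (i, j)).
Qed.

Lemma mx_norm_le m n (M : 'M[R]_(m, n)) c : 0 <= c ->
  (forall i j, `|M i j| <= c) -> `|M| <= c.
Proof.
move=> c0 Mc; rewrite [leLHS]/normr /= mx_normrE.
by apply/bigmax_leP; split=> // -[i j] _; exact: Mc.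
Qed.

Lemma mulmx_norm_le m n p (w : 'M[R]_(m, n)) (B : 'M[R]_(n, p)) :
  `|w *m B| <= n%:R * `|B| * `|w|.
Proof.
apply: mx_norm_le => [|i j]; first by rewrite !mulr_ge0.
rewrite mxE; apply: le_trans (ler_norm_sum _ _ _) _.
apply: le_trans (ler_sum _ (_ : forall k, true -> _ <= `|B| * `|w|)) _.
  by move=> k _; rewrite normrM mulrC; apply: ler_pM => //; exact: mx_entry_le_norm.
by rewrite sumr_const card_ord -[X in X <= _]mulr_natl mulrA.
Qed.

Lemma diff_line m (z u : 'rV[R]_m) (s : R) :
  differentiable (fun r : R => z + r *: u) s /\
  'd (fun r : R => z + r *: u) s 1 = u.
Proof.
have dr : differentiable (fun r : R => r *: u) s.
  exact: (@differentiableZl _ _ _ (fun r : R => r) u s).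
have dc : differentiable (fun r : R => z) s by exact: differentiable_cst.
split; first exact: (differentiableD dc dr).
have -> : (fun r : R => z + r *: u) = (fun r : R => z) + (fun r : R => r *: u).
  by [].
have e := congr1 (fun h : R -> 'rV[R]_m => h 1) (diffD dc dr).
have did : differentiable (fun r : R => r) s by exact: ex_diff.
have e1 := congr1 (fun h : R -> 'rV[R]_m => h 1) (diff_cst z s).
have e2 := congr1 (fun h : R -> 'rV[R]_m => h 1)
  (@diffZl _ _ _ (fun r : R => r) u s did).
have e3' : 'd (id : R -> R) s = id :> (R -> R) by exact: diff_val.
have e3 := congr1 (fun h : R -> R => h 1) e3'.
apply: etrans e _.
apply: etrans (congr2 +%R e1 (etrans e2 (congr1 ( *:%R^~ u) e3))) _.
by rewrite add0r scale1r.
Qed.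

(** Strict differentiability of a C^1 map: the mean value theorem on the segment
    from z to y, applied to each component, compares the increment with the
    Jacobian at an intermediate point, which is close to the one at a. *)
Lemma strong_diff m n (f : 'rV[R]_m -> 'rV[R]_n) a e : smooth_at f a -> 0 < e ->
  exists2 d, 0 < d & forall y z, `|y - a| < d -> `|z - a| < d ->
    `|f y - f z - (y - z) *m 'J f a| <= e * `|y - z|.
Proof.
move=> sf e0.
(* m.+1 rather than m, to divide by a nonzero number also in dimension 0 *)
have e1 : 0 < e / m.+1%:R by rewrite divr_gt0.
have Jc := smooth_at_continuous (smooth_at_jacobian sf).
have : \forall x \near a, smooth_at f x /\ `|'J f a - 'J f x| < e / m.+1%:R.
  by apply: filterS2 (smooth_at_near sf) ((cvgrPdist_lt _ _).1 Jc _ e1).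
move/(nbhs_ballP a) => [d /= d0 dP]; exists d => // y z ya za.
have {}dP x : `|x - a| < d -> smooth_at f x /\ `|'J f a - 'J f x| < e / m.+1%:R.
  by move=> xa; apply: dP; rewrite -ball_normE /= distrC.
pose u : 'rV[R]_m := y - z; pose l (s : R) : 'rV[R]_m := z + s *: u.
have lin_ball (s : R) : 0 <= s <= 1 -> `|l s - a| < d.
  move=> /andP[s0 s1].
  have -> : l s - a = (1 - s) *: (z - a) + s *: (y - a).
    rewrite /l /u; apply/rowP => i; rewrite !mxE; ring.
  apply: le_lt_trans (ler_normD _ _) _; rewrite !normrZ !ger0_norm ?subr_ge0 //.
  have [->|sn0] := eqVneq s 0; first by rewrite subr0 mul1r mul0r addr0.
  have sp : 0 < s by rewrite lt_neqAle eq_sym sn0.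
  have h1 : s * `|y - a| < s * d by rewrite ltr_pM2l.
  have h2 : (1 - s) * `|z - a| <= (1 - s) * d.
    by rewrite ler_wpM2l ?subr_ge0 // ltW.
  by rewrite (_ : d = (1 - s) * d + s * d) ?ler_ltD //; ring.
apply: mx_norm_le => [|i j]; first by rewrite mulr_ge0 // ltW.
rewrite ord1 {i}.
pose h s : R := f (l s) 0 j.
have dh (s : R) : 0 <= s <= 1 -> differentiable h s /\ 'd h s 1 = (u *m 'J f (l s)) 0 j.
  move=> s01; have [sfl _] := dP _ (lin_ball s s01).
  have [dl dlE] : differentiable l s /\ 'd l s 1 = u by exact: diff_line.
  have dfl := differentiable_comp dl (smooth_at_differentiable sfl).
  have cc : continuous (mxcoord 0 j : 'rV[R]_n -> R) by exact: coord_continuous.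
  split.
    exact: (differentiable_comp dfl (linear_differentiable _ cc)).
  have -> : h = mxcoord 0 j \o (f \o l) by [].
  rewrite (diff_comp dfl (linear_differentiable _ cc)) diff_lin //=.
  rewrite (diff_comp dl (smooth_at_differentiable sfl)) /=.
  by rewrite dlE diffJ.
have [] := @MVT R h (fun s => (u *m 'J f (l s)) 0 j) 0 1 ltr01.
- move=> s; rewrite in_itv /= => /andP[s0 s1].
  have [d1 d2] := dh s (introT andP (conj (ltW s0) (ltW s1))).
  apply: DeriveDef; first exact/derivable1_diffP.
  by rewrite deriveE.
- apply: derivable_within_continuous => s; rewrite in_itv /= => s01.
  by apply/derivable1_diffP; have [] := dh s s01.
move=> s; rewrite in_itv /= => /andP[s0 s1].
have l1 : l 1 = y by rewrite /l /u scale1r addrC subrK.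
have l0 : l 0 = z by rewrite /l scale0r addr0.
rewrite /h l1 l0 subr0 mulr1 /u => hE.
have -> : (f y - f z - (y - z) *m 'J f a) 0 j =
    ((y - z) *m ('J f (l s) - 'J f a)) 0 j.
  rewrite -[LHS]/(mxcoord 0 j _) -[RHS]/(mxcoord 0 j _) mulmxBr !raddfB /=.
  by rewrite /mxcoord hE.
apply: le_trans (mx_entry_le_norm _ _ _) _.
apply: le_trans (mulmx_norm_le _ _) _; rewrite ler_wpM2r //.
have [_ Jl] := dP _ (lin_ball s (introT andP (conj (ltW s0) (ltW s1)))).
rewrite distrC; apply: le_trans (_ : m.+1%:R * (e / m.+1%:R) <= _).
  by apply: ler_pM => //; [rewrite ler_nat|exact: ltW].
by rewrite mulrC divfK.
Qed.

(** At a minimum w of |f w| + |w|/4 over the ball of radius 5c, the Newton step to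
    w - f w would at least halve |f w| while moving w by |f w|, hence decrease the
    minimum, unless f w = 0.  The minimum is at most c, so that |w| <= 4c and the
    step stays in the ball. *)
Lemma exists_zero n (f : 'rV[R]_n -> 'rV[R]_n) c : 0 <= c -> `|f 0| <= c ->
  (forall w z, `|w| <= 5 * c -> `|z| <= 5 * c ->
     `|f w - f z - (w - z)| <= 2^-1 * `|w - z|) ->
  exists2 w, `|w| <= 4 * c & f w = 0.
Proof.
move=> c0 f0 fL.
pose K := [set w : 'rV[R]_n | `|w| <= 5 * c].
have K0 : K 0 by rewrite /K /= normr0 mulr_ge0.
have cK : compact K.
  apply: bounded_closed_compact.
    exists (5 * c); split; first exact: num_real.
    by move=> x cx w Kw; apply: le_trans Kw (ltW cx).
  have -> : K = (fun w : 'rV[R]_n => `|w|) @^-1` [set x | x <= 5 * c] by [].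
  by apply: closed_comp; [move=> w _; exact: norm_continuous|exact: closed_le].
have fc : {within K, continuous (fun w => `|f w| + 4^-1 * `|w|)}.
  apply/subspace_continuousP => w Kw; apply: cvgD.
    apply: cvg_norm; apply/cvgrPdist_lt => e e0.
    rewrite near_withinE; near=> z => Kz.
    have := fL w z Kw Kz => fwz.
    have : `|f w - f z| <= 2^-1 * `|w - z| + `|w - z|.
      by rewrite -[f w - f z](subrK (w - z)); apply: le_trans (ler_normD _ _) _; rewrite lerD2r.
    have : `|w - z| < e / 2 by near: z; apply: cvgr_dist_lt => //; exact: divr_gt0.
    lra.
  apply: cvgM; first exact: cvg_cst.
  apply: cvg_norm; exact: cvg_within.
have [w Kw wmin] := EVT_min_rV (ex_intro _ 0 K0) cK fc.
rewrite inE in Kw.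
have fw : `|f w| + 4^-1 * `|w| <= c.
  have := wmin 0; rewrite inE => /(_ K0); rewrite normr0 mulr0 addr0.
  by move=> /le_trans; apply.
have nw := normr_ge0 w; have nfw := normr_ge0 (f w).
have w4 : `|w| <= 4 * c by lra.
exists w => //; apply/eqP; rewrite -normr_le0.
pose z := w - f w.
have zw : `|z| <= `|w| + `|f w| by exact: ler_normB.
have Kz : K z by rewrite /K /=; lra.
have := wmin z; rewrite inE => /(_ Kz).
have zwE : z - w = - f w by rewrite /z addrAC subrr add0r.
have := fL z w Kz Kw; rewrite zwE normrN opprK subrK.
move: (normr_ge0 (f z)) zw; lra.
Unshelve. all: by end_near. Qed.

Lemma le0_of_small (x K : R) :
  (forall e, 0 < e -> e <= 1 -> x <= e * K) -> x <= 0.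
Proof.
move=> xK; rewrite leNgt; apply/negP => x0.
have K0 : 0 < K by have := xK 1 ltr01 (lexx _); lra.
have K2 : 0 < K + K by lra.
have := xK (Num.min 1 (x / (K + K))).
rewrite lt_min ltr01 divr_gt0 // ge_min lexx => /(_ isT isT).
rewrite leNgt => /negP; apply.
apply: le_lt_trans (_ : x / (K + K) * K < _).
  by apply: ler_wpM2r; [exact: ltW|rewrite ge_min lexx orbT].
rewrite -mulrA gtr_pMr // mulrC ltr_pdivrMr // mul1r; lra.
Qed.

(** With T a right inverse of the derivative of f, the map sending w to
    f (a + t v + w T) is close to the translation by f (a + t v), which is o(t) as
    v is in the kernel; so it has a zero w = o(t).  Then A vanishes at
    a + t v + w T, and dividing its first order expansion by t gives the claim.
    Only the inequality for each small e is used, with t depending on e. *)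
Lemma vanish_kernel m n p (f : 'rV[R]_m -> 'rV[R]_n) (A : 'rV[R]_m -> 'rV[R]_p)
    (a v : 'rV[R]_m) :
  smooth_at f a -> row_full ('J f a) -> f a = 0 -> v *m 'J f a = 0 ->
  smooth_at A a -> (\forall y \near a, f y = 0 -> A y = 0) -> v *m 'J A a = 0.
Proof.
move=> sf /row_fullP[T TJ] fa vJ sA fA.
have Aa : A a = 0 by apply: (nbhs_singleton fA).
apply/eqP; rewrite -normr_le0.
pose cT := n%:R * `|T|; pose cA := m%:R * `|'J A a|.
have cT0 : 0 <= cT by rewrite mulr_ge0.
have cA0 : 0 <= cA by rewrite mulr_ge0.
have wT (w : 'rV[R]_n) : `|w *m T| <= cT * `|w| by exact: mulmx_norm_le.
apply: (@le0_of_small _ (`|v| * (cA * (cT * 4) + (1 + cT * 4)))) => e e0 e1.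
have h0 : 0 < (2 * (cT + 1))^-1 by rewrite invr_gt0; lra.
have [d1 d10 fd1] := strong_diff sf h0.
have [d2 d20 fd2] := strong_diff sf e0.
have [d3 d30 Ad3] := strong_diff sA e0.
have [d4 /= d40 fAd4] := (nbhs_ballP _ _).1 fA.
pose d : R := Num.min (Num.min d1 d2) (Num.min d3 d4).
have d0 : 0 < d by rewrite !lt_min d10 d20 d30 d40.
(* small enough for all points used below to stay within distance d of a *)
pose t : R := d / ((`|v| + 1) * (2 + 5 * cT)).
have v0 := normr_ge0 v.
have D0 : 0 < (`|v| + 1) * (2 + 5 * cT) by apply: mulr_gt0; lra.
have t0 : 0 < t by rewrite divr_gt0.
have td : t * `|v| * (1 + 5 * cT) < d.
  rewrite /t -mulrA mulrAC ltr_pdivrMr // ltr_pM2l //.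
  have c1 : 0 <= `|v| * cT by exact: mulr_ge0.
  by rewrite mulrDl !mulrDr; lra.
have tv0 : 0 <= t * `|v| by rewrite mulr_ge0 // ltW.
have td' : t * `|v| < d.
  apply: le_lt_trans td; rewrite ler_peMr //; lra.
have dle (y : 'rV[R]_m) : `|y| < d -> [/\ `|y| < d1, `|y| < d2, `|y| < d3 & `|y| < d4].
  by rewrite !lt_min => /andP[/andP[-> ->] /andP[-> ->]].
have tvE : `|t *: v| = t * `|v| by rewrite normrZ gtr0_norm.
pose c : R := e * (t * `|v|).
have c0 : 0 <= c by rewrite mulr_ge0 // ltW.
have ctv : c <= t * `|v| by rewrite ler_piMl.
pose g w := f (a + (t *: v + w *m T)).
have aK (h : 'rV[R]_m) : a + h - a = h by rewrite addrAC subrr add0r.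
have gsmall w : `|w| <= 5 * c -> `|t *: v + w *m T| < d.
  move=> wc; apply: le_lt_trans td; apply: le_trans (ler_normD _ _) _.
  rewrite tvE mulrDr mulr1 lerD2l.
  apply: le_trans (wT _) _.
  rewrite mulrA [leRHS]mulrC; apply: ler_wpM2l => //; lra.
have g0 : `|g 0| <= c.
  rewrite /g mul0mx addr0; have [_ h _ _] := dle (t *: v) ltac:(by rewrite tvE).
  have := fd2 (a + t *: v) a; rewrite aK subrr normr0.
  by move=> /(_ h d20); rewrite fa subr0 -scalemxAl vJ scaler0 subr0 tvE.
have [w wc gw] : exists2 w, `|w| <= 4 * c & g w = 0.
  apply: exists_zero => // w z wc zc.
  have [hw _ _ _] := dle _ (gsmall w wc); have [hz _ _ _] := dle _ (gsmall z zc).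
  have := fd1 (a + (t *: v + w *m T)) (a + (t *: v + z *m T)).
  rewrite !aK => /(_ hw hz).
  have -> : a + (t *: v + w *m T) - (a + (t *: v + z *m T)) = (w - z) *m T.
    by rewrite !opprD addrACA subrr add0r addrACA subrr add0r -mulmxBl.
  rewrite -mulmxA TJ mulmx1 => Lwz.
  apply: le_trans Lwz _.
  apply: le_trans (_ : (2 * (cT + 1))^-1 * (cT * `|w - z|) <= _).
    by apply: ler_wpM2l => //; exact: ltW.
  rewrite mulrA ler_wpM2r // invfM -mulrA ler_piMr // mulrC ler_pdivrMr ?mul1r; lra.
pose h := t *: v + w *m T.
have hd : `|h| < d by apply: gsmall; apply: le_trans wc _; lra.
have [_ _ h3 h4] := dle _ hd.
have Ah : A (a + h) = 0.
  apply: fAd4; last by [].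
  by rewrite -ball_normE /= opprD addrA subrr add0r normrN.
have := Ad3 (a + h) a; rewrite aK subrr normr0 => /(_ h3 d30).
rewrite Ah Aa subr0 add0r normrN => hJ.
have hle : `|h| <= t * `|v| * (1 + cT * 4).
  apply: le_trans (ler_normD _ _) _; rewrite tvE mulrDr mulr1 lerD2l.
  apply: le_trans (wT _) _; rewrite (_ : t * `|v| * (cT * 4) = cT * (4 * (t * `|v|))); last by ring.
  apply: ler_wpM2l => //; lra.
have tvJ : t * `|v *m 'J A a| <= t * (e * (`|v| * (cA * (cT * 4) + (1 + cT * 4)))).
  have -> : t * `|v *m 'J A a| = `|h *m 'J A a - w *m T *m 'J A a|.
    by rewrite /h mulmxDl addrK -scalemxAl normrZ gtr0_norm.
  apply: le_trans (ler_normB _ _) _.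
  apply: le_trans (lerD hJ (mulmx_norm_le _ _)) _; rewrite -/cA.
  apply: le_trans (_ : e * (t * `|v| * (1 + cT * 4)) + cA * (cT * (4 * c)) <= _).
    apply: lerD; first by apply: ler_wpM2l => //; exact: ltW.
    apply: ler_wpM2l => //; apply: le_trans (wT _) _; exact: ler_wpM2l.
  by rewrite le_eqVlt; apply/orP; left; apply/eqP; rewrite /c; ring.
by rewrite ler_pM2l in tvJ.
Qed.

End ConstrainedCriticalPoints.

(** * Charts and Jacobians *)

Section ChartCalculus.
Context (R : realType).

Lemma cinvK T n (c : chart R T n) y : cimg c y -> c (cinv c y) = y.
Proof. by case=> x cx <-; rewrite cmapK. Qed.

Lemma cdom_cinv T n (c : chart R T n) y : cimg c y -> cdom c (cinv c y).
Proof. by case=> x cx <-; rewrite cmapK. Qed.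

Lemma cimg_near T n (c : chart R T n) x : cdom c x -> \forall y \near c x, cimg c y.
Proof.
by move=> cx; apply: open_nbhs_nbhs; split; [exact: cimg_open|exists x].
Qed.

Lemma chart_at_atlas n (M : manifold R n) (x : M) : matlas (chart_at x).
Proof. by have [] := projT2 (cid (matlas_cover x)). Qed.

Lemma chart_at_dom n (M : manifold R n) (x : M) : cdom (chart_at x) x.
Proof. by have [] := projT2 (cid (matlas_cover x)). Qed.

Lemma chart_atP n (M : manifold R n) (x : M) :
  exists c : chart R M n, [/\ c = chart_at x, matlas c & cdom c x].
Proof.
by exists (chart_at x); split=> //; [exact: chart_at_atlas|exact: chart_at_dom].
Qed.

Lemma near_cinv n (M : manifold R n) (c : chart R M n) (x : M) (P : M -> Prop) :
  matlas c -> cdom c x -> (\forall z \near x, P z) ->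
  \forall y \near c x, P (cinv c y).
Proof.
move=> Ac cx Px; have [_ _ cc] := mchart_homeo Ac.
have cix : cimg c (c x) by exists x.
by apply: (cc _ cix P); rewrite cmapK.
Qed.

Lemma near_chart n (M : manifold R n) (c : chart R M n) (x : M) (P : 'rV[R]_n -> Prop) :
  matlas c -> cdom c x -> (\forall y \near c x, P y) ->
  \forall z \near x, P (c z).
Proof. by move=> Ac cx Px; have [_ cc _] := mchart_homeo Ac; exact: (cc _ cx P). Qed.

Lemma cdom_near n (M : manifold R n) (c : chart R M n) (x : M) :
  matlas c -> cdom c x -> \forall z \near x, cdom c z.
Proof.
by move=> Ac cx; have [oc _ _] := mchart_homeo Ac; exact: open_nbhs_nbhs.
Qed.

Definition in_charts T S m n (c : chart R T m) (d : chart R S n) (f : T -> S)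
  (y : 'rV[R]_m) : 'rV[R]_n := d (f (cinv c y)).

End ChartCalculus.

(** The Jacobians are sealed, so that unification compares them by their
    arguments and never looks inside a differential. *)
HB.lock Definition jac_in (R : realType) T S m n (c : chart R T m)
    (d : chart R S n) (f : T -> S) (x : T) : 'M[R]_(m, n) :=
  'J (in_charts c d f) (c x).

HB.lock Definition dmap (R : realType) m n (M : manifold R m) (N : manifold R n)
    (f : M -> N) (x : M) : 'M[R]_(m, n) := tmap f x.

HB.lock Definition dchart (R : realType) n (M : manifold R n) (c : chart R M n)
    (x : M) : 'M[R]_n := to_chart c x.

Section ChartJacobians.
Context (R : realType).

Lemma in_chartsE T S m n (c : chart R T m) (d : chart R S n) (f : T -> S) x :
  cdom c x -> in_charts c d f (c x) = d (f x).
Proof. by move=> cx; rewrite /in_charts cmapK. Qed.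

Lemma smooth_in_charts m n (M : manifold R m) (N : manifold R n) (f : M -> N)
    (c : chart R M m) (d : chart R N n) x : smooth f ->
  matlas c -> matlas d -> cdom c x -> cdom d (f x) ->
  smooth_at (in_charts c d f) (c x) /\
  \forall y \near c x, cimg c y /\ cdom d (f (cinv c y)).
Proof.
move=> sf Ac Ad cx dfx.
have [||U [F [oU Ux CF FE]]] := sf _ c _ d x _ _ I cx dfx; [by exists c|by exists d|].
have nU : \forall y \near c x, cimg c y /\ U y.
  by apply: filterI; [exact: cimg_near|exact: open_nbhs_nbhs].
have FE' y : cimg c y /\ U y -> cdom d (f (cinv c y)) /\ F y = d (f (cinv c y)).
  move=> [ciy Uy]; have := FE _ (cdom_cinv ciy) I.
  by rewrite cinvK // => /(_ Uy).
split; last by apply: filterS nU => y yU; have [] := FE' y yU; case: yU.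
apply: (smooth_at_eq _ (Cinf_smooth_at oU Ux CF)).
by apply: filterS nU => y /FE'[].
Qed.

(** Compatibility of the charts is the smoothness of the identity; change of
    coordinates thereby becomes a special case of the chain rule. *)
Lemma smooth_id n (M : manifold R n) : smooth (@id M).
Proof.
move=> m c p d x [c' Ac ec] [d' Ad ed] _.
have [_ /(_ m c p d)] := @matlasP R n M.
case=> [||oU CU cx dx]; [by exists c'|by exists d'|].
exists (c @` (cdom c `&` cdom d)), (fun y => d (cinv c y)); split => //.
  by exists x.
move=> z cz _ [z' [cz' dz'] zz'].
have <- : z' = z by rewrite -(cmapK cz') -(cmapK cz) zz'.
by rewrite /= cmapK.
Qed.

Lemma smooth_near_cinv m n (M : manifold R m) (N : manifold R n) (f : M -> N)
    (c : chart R M m) x (P : N -> Prop) : smooth f -> matlas c -> cdom c x ->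
  (\forall z \near f x, P z) -> \forall y \near c x, P (f (cinv c y)).
Proof.
move=> sf Ac cx Px; pose d := chart_at (f x).
have Ad : matlas d := chart_at_atlas (f x).
have dfx : cdom d (f x) := chart_at_dom (f x).
have [sfc nd] := smooth_in_charts sf Ac Ad cx dfx.
have Pd := near_cinv Ad dfx Px.
have Pd' : nbhs (in_charts c d f (c x)) (fun z => P (cinv d z)).
  by rewrite /in_charts cmapK.
have := smooth_at_continuous sfc Pd'.
by apply: filterS2 nd => y [_ dy]; rewrite /= /in_charts cmapK.
Qed.

(** The chain rule, for any choice of the three charts: [dmap_comp], [dchart_jac] and
    [dchart_trans] follow from it. *)
Lemma jac_in_comp m n p (M : manifold R m) (N : manifold R n) (P : manifold R p)
    (f : M -> N) (g : N -> P) c d e x : smooth f -> smooth g ->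
  matlas c -> matlas d -> matlas e ->
  cdom c x -> cdom d (f x) -> cdom e (g (f x)) ->
  jac_in c e (g \o f) x = jac_in c d f x *m jac_in d e g (f x).
Proof.
move=> sf sg Ac Ad Ae cx dfx egfx.
have [sfc nd] := smooth_in_charts sf Ac Ad cx dfx.
have [sgc _] := smooth_in_charts sg Ad Ae dfx egfx.
have fcx : in_charts c d f (c x) = d (f x) by rewrite /in_charts cmapK.
have dfc := smooth_at_differentiable sfc.
have dgc : differentiable (in_charts d e g) (in_charts c d f (c x)).
  by rewrite fcx; exact: smooth_at_differentiable.
have := jacobian_comp dfc dgc; rewrite fcx => e1.
rewrite jac_in.unlock -e1; apply/esym/jacobian_near; last exact: differentiable_comp.
by apply: filterS nd => y [_ dy]; rewrite /in_charts /= cmapK.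
Qed.

Lemma jac_in_id n (M : manifold R n) (c : chart R M n) x :
  matlas c -> cdom c x -> jac_in c c id x = 1%:M.
Proof.
move=> Ac cx.
have [sc nc] := smooth_in_charts (@smooth_id _ M) Ac Ac cx (cx : cdom c (id x)).
rewrite jac_in.unlock.
have -> : 'J (in_charts c c id) (c x) = 'J id (c x).
  apply: jacobian_near; last exact: smooth_at_differentiable.
  by apply: filterS nc => y [ciy _]; rewrite /in_charts cinvK.
have did : 'd id (c x) = id :> ('rV[R]_n -> 'rV[R]_n) by exact: diff_val.
by apply: mulmx_ext => v; rewrite -diffJ mulmx1 did.
Qed.

Lemma dmapE m n (M : manifold R m) (N : manifold R n) (f : M -> N) x :
  dmap f x = jac_in (chart_at x) (chart_at (f x)) f x.
Proof. by rewrite dmap.unlock jac_in.unlock. Qed.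

Lemma dchartE n (M : manifold R n) (c : chart R M n) x :
  dchart c x = jac_in (chart_at x) c id x.
Proof. by rewrite dchart.unlock jac_in.unlock. Qed.

Lemma dchart_jac m n (M : manifold R m) (N : manifold R n) (f : M -> N)
    (c : chart R M m) (d : chart R N n) x : smooth f ->
  matlas c -> matlas d -> cdom c x -> cdom d (f x) ->
  dchart c x *m jac_in c d f x = dmap f x *m dchart d (f x).
Proof.
move=> sf Ac Ad cx dfx.
have [c0 [c0E Ac0 c0x]] := chart_atP x; have [d0 [d0E Ad0 d0x]] := chart_atP (f x).
rewrite !dchartE dmapE -c0E -d0E.
have e1 := jac_in_comp (@smooth_id _ M) sf Ac0 Ac Ad c0x cx dfx.
have e2 := jac_in_comp sf (@smooth_id _ N) Ac0 Ad0 Ad c0x d0x dfx.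
exact: etrans (esym e1) e2.
Qed.

Lemma dchart_unit n (M : manifold R n) (c : chart R M n) x :
  matlas c -> cdom c x -> dchart c x \in unitmx.
Proof.
move=> Ac cx; have [c0 [c0E Ac0 c0x]] := chart_atP x.
have e1 := jac_in_comp (@smooth_id _ M) (@smooth_id _ M) Ac0 Ac Ac0 c0x cx c0x.
have e2 := etrans (esym e1) (jac_in_id Ac0 c0x).
by rewrite dchartE -c0E; have [] := mulmx1_unit e2.
Qed.

Lemma dchart_trans n (M : manifold R n) (c d : chart R M n) x :
  matlas c -> matlas d -> cdom c x -> cdom d x ->
  dchart c x *m jac_in c d id x = dchart d x.
Proof.
move=> Ac Ad cx dx; have [c0 [c0E Ac0 c0x]] := chart_atP x.
rewrite !dchartE -c0E; apply: esym.
exact: (jac_in_comp (@smooth_id _ M) (@smooth_id _ M) Ac0 Ac Ad c0x cx dx).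
Qed.

Lemma dmap_comp m n p (M : manifold R m) (N : manifold R n) (P : manifold R p)
    (f : M -> N) (g : N -> P) x : smooth f -> smooth g ->
  dmap (g \o f) x = dmap f x *m dmap g (f x).
Proof.
move=> sf sg; rewrite !dmapE.
by apply: jac_in_comp => //; solve [exact: chart_at_atlas|exact: chart_at_dom].
Qed.

Lemma dmap_id n (M : manifold R n) (x : M) : dmap id x = 1%:M.
Proof. by rewrite dmapE; apply: jac_in_id; [exact: chart_at_atlas|exact: chart_at_dom]. Qed.

Lemma smooth_jac_in m n (M : manifold R m) (N : manifold R n) (f : M -> N)
    (c : chart R M m) (d : chart R N n) x : smooth f ->
  matlas c -> matlas d -> cdom c x -> cdom d (f x) ->
  smooth_at (fun y => jac_in c d f (cinv c y)) (c x).
Proof.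
move=> sf Ac Ad cx dfx.
have [sfc _] := smooth_in_charts sf Ac Ad cx dfx.
apply: smooth_at_eq (smooth_at_jacobian sfc).
by apply: filterS (cimg_near cx) => y cy; rewrite jac_in.unlock cinvK.
Qed.

End ChartJacobians.

(** * Differentiating the partial multiplication *)

Section JacobianRules.
Context (R : realType).

Lemma jacobian_lin p q (L : {linear 'rV[R]_p -> 'rV[R]_q}) y (v : 'rV[R]_p) :
  continuous L -> v *m 'J L y = L v.
Proof. by move=> Lc; rewrite -diffJ diff_lin. Qed.

Lemma jacobianB p q (f g : 'rV[R]_p -> 'rV[R]_q) y (v : 'rV[R]_p) :
  differentiable f y -> differentiable g y ->
  v *m 'J (fun z => f z - g z) y = v *m 'J f y - v *m 'J g y.
Proof.
move=> df dg.
have e := congr1 (fun h : 'rV[R]_p -> 'rV[R]_q => h v) (diffB df dg).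
apply: etrans (esym (diffJ _ y v)) (etrans e _).
exact: (congr2 (fun a b => a - b) (diffJ f y v) (diffJ g y v)).
Qed.

Lemma jacobian_lsub p q r (f : 'rV[R]_p -> 'rV[R]_r) (y v : 'rV[R]_(p + q)) :
  differentiable f (lsubmx y) ->
  v *m 'J (fun z => f (lsubmx z)) y = lsubmx v *m 'J f (lsubmx y).
Proof.
move=> df; rewrite (jacobian_comp (differentiable_lsubmx y) df) mulmxA.
by rewrite jacobian_lin //; exact: continuous_lsubmx.
Qed.

Lemma jacobian_rsub p q r (f : 'rV[R]_q -> 'rV[R]_r) (y v : 'rV[R]_(p + q)) :
  differentiable f (rsubmx y) ->
  v *m 'J (fun z => f (rsubmx z)) y = rsubmx v *m 'J f (rsubmx y).
Proof.
move=> df; rewrite (jacobian_comp (differentiable_rsubmx y) df) mulmxA.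
by rewrite jacobian_lin //; exact: continuous_rsubmx.
Qed.

Lemma smooth_at_lsub p q r (f : 'rV[R]_p -> 'rV[R]_r) (y : 'rV[R]_(p + q)) :
  smooth_at f (lsubmx y) -> smooth_at (fun z => f (lsubmx z)) y.
Proof. by apply: smooth_at_comp; exact: smooth_at_lsubmx (smooth_at_id y). Qed.

Lemma smooth_at_rsub p q r (f : 'rV[R]_q -> 'rV[R]_r) (y : 'rV[R]_(p + q)) :
  smooth_at f (rsubmx y) -> smooth_at (fun z => f (rsubmx z)) y.
Proof. by apply: smooth_at_comp; exact: smooth_at_rsubmx (smooth_at_id y). Qed.

Lemma near_lsub p q (y : 'rV[R]_(p + q)) (P : 'rV[R]_p -> Prop) :
  (\forall z \near lsubmx y, P z) -> \forall z \near y, P (lsubmx z).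
Proof. by move=> Py; exact: (continuous_lsubmx Py). Qed.

Lemma near_rsub p q (y : 'rV[R]_(p + q)) (P : 'rV[R]_q -> Prop) :
  (\forall z \near rsubmx y, P z) -> \forall z \near y, P (rsubmx z).
Proof. by move=> Py; exact: (continuous_rsubmx Py). Qed.

End JacobianRules.

Section PartialMultiplication.
Context (R : realType) (n k : nat) (M : manifold R n) (G : manifold R k).
Context (GG : lie_groupoid M G).
Local Notation s := (src GG).
Local Notation t := (tgt GG).

Lemma smooth_src : smooth s. Proof. exact: src_smooth. Qed.
Lemma smooth_tgt : smooth t. Proof. exact: tgt_smooth. Qed.
Lemma smooth_unit : smooth (gunit GG). Proof. exact: unit_smooth. Qed.

Lemma dsrc_full g : row_full (dmap s g).
Proof. by rewrite dmap.unlock; exact: src_submersion. Qed.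

(** Z is the derivative at (g, h), in the direction (X, Y), of an extension of the
    multiplication.  Both conclusions differentiate a function vanishing on
    composable pairs: the difference of the coordinates of pi (g' h') and of the
    coordinates of sg g', respectively sg h'. *)
Lemma comp_tangent (g h : G) (X Y : 'rV[R]_k) : s g = t h ->
  X *m dmap s g = Y *m dmap t h ->
  exists Z : 'rV[R]_k, forall pi sg : G -> M, smooth pi -> smooth sg ->
    ((forall g' h', s g' = t h' -> pi (gmul GG g' h') = sg g') ->
       Z *m dmap pi (gmul GG g h) = X *m dmap sg g) /\
    ((forall g' h', s g' = t h' -> pi (gmul GG g' h') = sg h') ->
       Z *m dmap pi (gmul GG g h) = Y *m dmap sg h).
Proof.
move=> gh XY.
have [c [cE Ac cg]] := chart_atP g; have [d [dE Ad dh]] := chart_atP h.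
have [b [bE Ab bgh]] := chart_atP (gmul GG g h).
have [a [aE Aa asg]] := chart_atP (s g).
have ath : cdom a (t h) by rewrite -gh.
pose p0 := row_mx (c g) (d h).
have lp0 : lsubmx p0 = c g by exact: row_mxKl.
have rp0 : rsubmx p0 = d h by exact: row_mxKr.
have [||U [F [oU Up0 CF FE]]] := @mul_smooth _ _ _ _ _ GG _ (prod_chart c d) _ b
    (g, h) _ _ gh (conj cg dh) bgh.
- by exists k, c, k, d; split; [exists c|exists d|reflexivity].
- by exists b.
rewrite /= -/p0 in Up0.
have sF : smooth_at F p0 := Cinf_smooth_at oU Up0 CF.
have [ssc nsc] := smooth_in_charts smooth_src Ac Aa cg asg.
have [std ntd] := smooth_in_charts smooth_tgt Ad Aa dh ath.
pose phi (y : 'rV[R]_(k + k)) : 'rV[R]_n :=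
  in_charts c a s (lsubmx y) - in_charts d a t (rsubmx y).
have ssc' : smooth_at (in_charts c a s) (lsubmx p0) by rewrite lp0.
have std' : smooth_at (in_charts d a t) (rsubmx p0) by rewrite rp0.
have dl := smooth_at_lsub ssc'; have dr := smooth_at_rsub std'.
have sphi : smooth_at phi p0 by exact: smooth_atB.
have phiJ (v : 'rV[R]_(k + k)) :
    v *m 'J phi p0 = lsubmx v *m dmap s g - rsubmx v *m dmap t h.
  have e := jacobianB v (smooth_at_differentiable dl) (smooth_at_differentiable dr).
  have el := jacobian_lsub v (smooth_at_differentiable ssc').
  have er := jacobian_rsub v (smooth_at_differentiable std').
  apply: etrans e (etrans (congr2 (fun a b => a - b) el er) _).
  by rewrite lp0 rp0 !dmapE -gh -cE -dE -aE jac_in.unlock.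
(* the source alone already makes the constraint a submersion *)
have phifull : row_full ('J phi p0).
  have /row_fullP[L LS] := dsrc_full g.
  apply/row_fullP; exists (row_mx L 0); apply: mulmx_ext => v.
  rewrite mulmxA mul_mx_row mulmx0 phiJ row_mxKl row_mxKr mul0mx subr0.
  by rewrite -mulmxA LS.
have phi0 : phi p0 = 0.
  rewrite /phi lp0 rp0; apply/eqP; rewrite subr_eq0; apply/eqP.
  exact: etrans (in_chartsE a s cg) (etrans (congr1 a gh) (esym (in_chartsE a t dh))).
have phiXY : row_mx X Y *m 'J phi p0 = 0.
  by rewrite phiJ row_mxKl row_mxKr XY subrr.
(* near p0, the zeros of phi are the coordinates of composable pairs *)
have near_comp : \forall y \near p0, phi y = 0 ->
    let g' := cinv c (lsubmx y) in let h' := cinv d (rsubmx y) in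
    [/\ s g' = t h', cinv b (F y) = gmul GG g' h',
        c g' = lsubmx y & d h' = rsubmx y].
  have n1 : \forall y \near p0, cimg c (lsubmx y) /\ cdom a (s (cinv c (lsubmx y))).
    by apply: (near_lsub (P := fun y => cimg c y /\ cdom a (s (cinv c y)))); rewrite lp0.
  have n2 : \forall y \near p0, cimg d (rsubmx y) /\ cdom a (t (cinv d (rsubmx y))).
    by apply: (near_rsub (P := fun y => cimg d y /\ cdom a (t (cinv d y)))); rewrite rp0.
  have n3 : \forall y \near p0, U y.
    exact: open_nbhs_nbhs (conj oU Up0).
  apply: filterS3 n1 n2 n3 => y [cy asy] [dy aty] Uy /subr0_eq phiy g' h'.
  have st : s g' = t h'.
    by rewrite -(cmapK asy) -(cmapK aty); congr (cinv a _); exact: phiy.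
  have cy' : c g' = lsubmx y := cinvK cy.
  have dy' : d h' = rsubmx y := cinvK dy.
  have zE : row_mx (c g') (d h') = y by rewrite cy' dy' hsubmxK.
  have [] := FE (g', h') (conj (cdom_cinv cy) (cdom_cinv dy)) st.
    by rewrite /= zE.
  rewrite /= zE => bm Fm; split.
  - exact: st.
  - exact: etrans (congr1 (cinv b) Fm) (cmapK bm).
  - exact: cy'.
  - exact: dy'.
have FmE : F p0 = b (gmul GG g h) by have [] := FE (g, h) (conj cg dh) gh Up0.
exists (row_mx X Y *m 'J F p0) => pi sg spi ssg.
split=> H.
- have piE : pi (gmul GG g h) = sg g by exact: H.
  have [e [eE Ae esg]] := chart_atP (sg g).
  have epi : cdom e (pi (gmul GG g h)) by rewrite piE.
  have [s1 _] := smooth_in_charts spi Ab Ae bgh epi.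
  have [s2 _] := smooth_in_charts ssg Ac Ae cg esg.
  rewrite -FmE in s1; rewrite -lp0 in s2.
  have s3 := smooth_at_comp sF s1; have s4 := smooth_at_lsub s2.
  have := vanish_kernel sphi phifull phi0 phiXY (smooth_atB s3 s4).
  have e1 := jacobianB (row_mx X Y) (smooth_at_differentiable s3)
    (smooth_at_differentiable s4).
  have e2 := jacobian_lsub (row_mx X Y) (smooth_at_differentiable s2).
  have e3 := jacobian_comp (smooth_at_differentiable sF) (smooth_at_differentiable s1).
  have e123 := etrans e1 (congr2 (fun a b => a - b) (congr1 (mulmx _) e3) e2).
  move=> V; have {V} := etrans (esym e123) (V _).
  rewrite row_mxKl lp0 mulmxA FmE => V.
  apply/subr0_eq; rewrite !dmapE piE -eE -bE -?cE -?dE jac_in.unlock; apply: V.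
  apply: filterS near_comp => y h0 /h0[st bF cE' dE'].
  apply/eqP; rewrite subr_eq0; apply/eqP.
  by have e4 := etrans (congr1 pi bF) (H _ _ st); rewrite /in_charts e4.
- have piE : pi (gmul GG g h) = sg h by exact: H.
  have [e [eE Ae esg]] := chart_atP (sg h).
  have epi : cdom e (pi (gmul GG g h)) by rewrite piE.
  have [s1 _] := smooth_in_charts spi Ab Ae bgh epi.
  have [s2 _] := smooth_in_charts ssg Ad Ae dh esg.
  rewrite -FmE in s1; rewrite -rp0 in s2.
  have s3 := smooth_at_comp sF s1; have s4 := smooth_at_rsub s2.
  have := vanish_kernel sphi phifull phi0 phiXY (smooth_atB s3 s4).
  have e1 := jacobianB (row_mx X Y) (smooth_at_differentiable s3)
    (smooth_at_differentiable s4).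
  have e2 := jacobian_rsub (row_mx X Y) (smooth_at_differentiable s2).
  have e3 := jacobian_comp (smooth_at_differentiable sF) (smooth_at_differentiable s1).
  have e123 := etrans e1 (congr2 (fun a b => a - b) (congr1 (mulmx _) e3) e2).
  move=> V; have {V} := etrans (esym e123) (V _).
  rewrite row_mxKr rp0 mulmxA FmE => V.
  apply/subr0_eq; rewrite !dmapE piE -eE -bE -?cE -?dE jac_in.unlock; apply: V.
  apply: filterS near_comp => y h0 /h0[st bF cE' dE'].
  apply/eqP; rewrite subr_eq0; apply/eqP.
  by have e4 := etrans (congr1 pi bF) (H _ _ st); rewrite /in_charts e4.
Qed.

Lemma mul_tangent (g h : G) (X Y : 'rV[R]_k) : s g = t h ->
  X *m dmap s g = Y *m dmap t h ->
  exists Z : 'rV[R]_k, Z *m dmap s (gmul GG g h) = Y *m dmap s h /\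
    Z *m dmap t (gmul GG g h) = X *m dmap t g.
Proof.
move=> gh XY; have [Z ZE] := comp_tangent gh XY; exists Z; split.
  have [_] := ZE _ _ smooth_src smooth_src; apply.
  by move=> g' h' gh'; exact: src_mul.
have [+ _] := ZE _ _ smooth_tgt smooth_tgt; apply.
by move=> g' h' gh'; exact: tgt_mul.
Qed.

End PartialMultiplication.

(** * The normal representation *)

Section Quotients.
Context (R : realType) (n : nat).

Lemma coset_eqP (W : set 'rV[R]_n) (v w : 'rV[R]_n) :
  W 0 -> (forall a b, W a -> W b -> W (a - b)) ->
  coset W v = coset W w <-> W (v - w).
Proof.
move=> W0 WB; split=> [e|vw].
  have : coset W v v by rewrite /coset /= subrr.
  by rewrite e.
apply/seteqP; split=> a; rewrite /coset /= => av.
  rewrite -(subrKA v a (- w)) -[v - w]opprB; apply: (WB _ _ av).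
  by rewrite -[w - v]opprB -sub0r; exact: WB.
by rewrite -(subrKA w a (- v)) -[w - v]opprB; exact: WB.
Qed.

Context (M : manifold R n) (W : M -> set 'rV[R]_n).

Lemma quot_ext (e e' : quot_bundle W) :
  qbase e = qbase e' -> qclass e = qclass e' -> e = e'.
Proof.
case: e e' => x C p [x' C' p'] /= xx CC; subst x' C'.
by rewrite (Prop_irrelevance p p').
Qed.

Lemma qpt_eqP x (v w : 'rV[R]_n) :
  W x 0 -> (forall a b, W x a -> W x b -> W x (a - b)) ->
  qpt W x v = qpt W x w <-> W x (v - w).
Proof.
move=> W0 WB; split=> [e|vw].
  by have /= ec := congr1 (@qclass _ _ _ W) e; apply/coset_eqP.
by apply: quot_ext => //; apply/coset_eqP.
Qed.

Lemma quot_qpt (e : quot_bundle W) : exists v, e = qpt W (qbase e) v.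
Proof. by have [v ev] := qclassP e; exists v; apply: quot_ext. Qed.

End Quotients.

Section NormalRepresentation.
Context (R : realType) (n k : nat) (M : manifold R n) (G : manifold R k).
Context (GG : lie_groupoid M G).
Local Notation s := (src GG).
Local Notation t := (tgt GG).
Local Notation W := (im_anchor GG).
Local Notation "1_ x" := (gunit GG x) (at level 0, x at level 2).

Lemma im_anchorP (x : M) (v : 'rV[R]_n) : W x v <->
  exists2 X : 'rV[R]_k, X *m dmap s (1_ x) = 0 & v = X *m dmap t (1_ x).
Proof.
rewrite /im_anchor /anchor dmap.unlock /=.
split=> [/submxP[D ->]|[X X0 ->]].
  exists (D *m kermx (tmap s (1_ x))); last by rewrite mulmxA.
  by rewrite -mulmxA mulmx_ker mulmx0.
by rewrite submxMr // sub_kermx X0.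
Qed.

Lemma orbit_tangentP (x y : M) (u : 'rV[R]_n) : orbit_tangent GG x y u <->
  exists (g : G) (X : 'rV[R]_k),
    [/\ s g = x, t g = y, X *m dmap s g = 0 & u = X *m dmap t g].
Proof. by rewrite dmap.unlock. Qed.

(** Right translation by the inverse of h moves a vector of ker ds at h to the unit
    at its target, and right translation by g moves it back; neither changes dt. *)
Lemma orbit_tangentE (x y : M) : gorbit GG x y -> orbit_tangent GG x y = W y.
Proof.
move=> [g sg tg]; apply/seteqP; split=> u.
  move=> /orbit_tangentP[h [X [sh th X0 ->]]]; apply/im_anchorP.
  have hV : s h = t (ginv GG h) by rewrite tgt_inv.
  have [|Z] := @mul_tangent _ _ _ _ _ GG _ _ X 0 hV; first by rewrite X0 mul0mx.
  rewrite gmulgV th mul0mx => -[Z0 ZX].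
  exact: ex_intro2 Z0 (esym ZX).
move=> /im_anchorP[X X0 ->].
have yg : s (1_ y) = t g by rewrite src_unit tg.
have [|Z] := @mul_tangent _ _ _ _ _ GG _ _ X 0 yg; first by rewrite X0 mul0mx.
rewrite mul0mx -tg gmul1g => -[Z0 ZX].
apply/orbit_tangentP; exists g, Z; split; [exact: sg|reflexivity|exact: Z0|exact: esym ZX].
Qed.

Lemma gorbit_src g : gorbit GG (s g) (s g).
Proof. by exists (1_ (s g)); [exact: src_unit|exact: tgt_unit]. Qed.

Lemma gorbit_tgt g : gorbit GG (s g) (t g).
Proof. by exists g. Qed.

(** If ds X = dt Y with Y in the Lie algebroid at s g, then composing X with Y
    yields a vector at g = g 1 with the same image under dt as X and in the
    kernel of ds; so dt X is tangent to the orbit. *)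
Lemma src_tangent_anchor g (X : 'rV[R]_k) : W (s g) (X *m dmap s g) ->
  W (t g) (X *m dmap t g).
Proof.
move=> /im_anchorP[Y Y0 XY].
have [|Z] := @mul_tangent _ _ _ _ _ GG g (1_ (s g)) X Y _ XY.
  by rewrite tgt_unit.
rewrite gmulg1 Y0 -(orbit_tangentE (gorbit_tgt g)) => -[Z0 ZX].
apply/orbit_tangentP; exists g, Z; split; [reflexivity|reflexivity|exact: Z0|exact: esym ZX].
Qed.

Lemma src_lift g (v : 'rV[R]_n) : exists X : 'rV[R]_k, X *m dmap s g = v.
Proof.
by have /row_fullP[L LS] := dsrc_full GG g; exists (v *m L); rewrite -mulmxA LS mulmx1.
Qed.

Lemma im_anchor0 x : W x 0.
Proof. exact: sub0mx. Qed.

Lemma im_anchorB x (a b : 'rV[R]_n) : W x a -> W x b -> W x (a - b).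
Proof. by move=> Wa Wb; apply: addmx_sub => //; rewrite eqmx_opp. Qed.

Lemma anchor_qpt_eqP x (v w : 'rV[R]_n) : qpt W x v = qpt W x w <-> W x (v - w).
Proof. by apply: qpt_eqP; [exact: im_anchor0|exact: im_anchorB]. Qed.

(** The lift of a representative v is v times a pseudo-inverse of ds; by
    [normal_repE] any other lift gives the same class. *)
Definition normal_rep (g : G) (e : normal_bundle GG) : normal_bundle GG :=
  qpt W (t g)
    (xget 0 [set v | qclass e = coset (W (qbase e)) v] *m
       pinvmx (dmap s g) *m dmap t g).

(** Two lifts of the same class differ by a vector whose image under ds is in the
    image of the anchor. *)
Lemma normal_repE g (X : 'rV[R]_k) :
  normal_rep g (qpt W (s g) (X *m dmap s g)) = qpt W (t g) (X *m dmap t g).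
Proof.
rewrite /normal_rep /=; set v := xget _ _; apply/anchor_qpt_eqP.
rewrite -mulmxBl; apply: src_tangent_anchor; rewrite mulmxBl mulmxKpV; last first.
  by apply: submx_full; exact: dsrc_full.
have : coset (W (s g)) (X *m dmap s g) = coset (W (s g)) v.
  exact: (xgetPex 0 (P := [set v | coset (W (s g)) (X *m dmap s g) =
    coset (W (s g)) v]) (ex_intro _ (X *m dmap s g) erefl)).
by move/esym/(coset_eqP _ _ (im_anchor0 (s g)) (@im_anchorB (s g))).
Qed.

Lemma normal_rep_base g e : qbase (normal_rep g e) = t g.
Proof. by []. Qed.

(** At a unit, du v lifts v, and dt also maps it to v. *)
Lemma normal_rep_unit e : normal_rep (1_ (qbase e)) e = e.
Proof.
have [v ->] := quot_qpt e; rewrite /=; move: (qbase e) => x.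
have us : v *m dmap (gunit GG) x *m dmap s (1_ x) = v.
  rewrite -mulmxA -(dmap_comp x (@smooth_unit _ _ _ _ _ GG) (@smooth_src _ _ _ _ _ GG)).
  have -> : s \o gunit GG = id by apply/funext => y; rewrite /= src_unit.
  by rewrite dmap_id mulmx1.
have ut : v *m dmap (gunit GG) x *m dmap t (1_ x) = v.
  rewrite -mulmxA -(dmap_comp x (@smooth_unit _ _ _ _ _ GG) (@smooth_tgt _ _ _ _ _ GG)).
  have -> : t \o gunit GG = id by apply/funext => y; rewrite /= tgt_unit.
  by rewrite dmap_id mulmx1.
have := normal_repE (1_ x) (v *m dmap (gunit GG) x).
by rewrite us ut src_unit tgt_unit => ->.
Qed.

Lemma normal_rep_mul g h e : s g = t h -> s h = qbase e ->
  normal_rep (gmul GG g h) e = normal_rep g (normal_rep h e).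
Proof.
move=> gh he; have [v ->] := quot_qpt e; rewrite -he.
have [Y <-] := src_lift h v.
have [X XY] := src_lift g (Y *m dmap t h).
have [Z [Zs Zt]] := mul_tangent gh XY.
rewrite normal_repE -gh -XY normal_repE -Zs -Zt -(tgt_mul gh).
by rewrite -{1}(src_mul gh) normal_repE.
Qed.

Lemma normal_repK g e : s g = qbase e ->
  normal_rep (ginv GG g) (normal_rep g e) = e.
Proof.
by move=> ge; rewrite -normal_rep_mul ?src_inv // gmulVg ge normal_rep_unit.
Qed.

Lemma normal_repVK g e : t g = qbase e ->
  normal_rep g (normal_rep (ginv GG g) e) = e.
Proof.
move=> ge; rewrite -normal_rep_mul ?tgt_inv ?src_inv //.
by rewrite gmulgV ge normal_rep_unit.
Qed.

Lemma normal_rep_representation : representation GG normal_rep.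
Proof.
split.
- move=> g; split.
  + by move=> e _; exact: normal_rep_base.
  + move=> e e'; rewrite !inE /= => eg e'g ee'.
    by rewrite -(normal_repK (esym eg)) ee' normal_repK.
  + move=> e /= eg; exists (normal_rep (ginv GG g) e); last exact: normal_repVK.
    by rewrite /= tgt_inv.
- move=> g a u v u' v'.
  have [X <-] := src_lift g u; have [Y <-] := src_lift g v.
  rewrite !normal_repE => /anchor_qpt_eqP Xu /anchor_qpt_eqP Yv.
  rewrite scalemxAl -mulmxDl normal_repE; apply/anchor_qpt_eqP.
  rewrite mulmxDl -scalemxAl opprD addrACA -scalerBr.
  by apply: addmx_sub => //; exact: scalemx_sub.
- by move=> e; exact: normal_rep_unit.
- by move=> g h e; exact: normal_rep_mul.
Qed.

Lemma orbit_normal_repE (x : M) (g : G) (C : set 'rV[R]_n) :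
  orbit_normal_rep GG x g C = [set u | exists2 X : 'rV[R]_k, C (X *m dmap s g) &
    coset (orbit_tangent GG x (t g)) (X *m dmap t g) u].
Proof. by rewrite dmap.unlock. Qed.

(** On an orbit the two quotients agree, and the orbitwise definition ranges over
    all lifts of all representatives, which share their class. *)
Lemma normal_rep_orbitwise (x : M) (g : G) (v : 'rV[R]_n) :
  gorbit GG x (s g) -> gorbit GG x (t g) ->
  coset (orbit_tangent GG x (s g)) v = qclass (qpt W (s g) v) /\
  qclass (normal_rep g (qpt W (s g) v)) =
    orbit_normal_rep GG x g (coset (orbit_tangent GG x (s g)) v).
Proof.
move=> xs xt; rewrite orbit_normal_repE !orbit_tangentE //; split=> //.
have [X0 <-] := src_lift g v; rewrite normal_repE /=.
apply/seteqP; split=> [u uX|u [X XX uX]].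
  have h : coset (W (s g)) (X0 *m dmap s g) (X0 *m dmap s g).
    by rewrite /coset /= subrr; exact: sub0mx.
  by exists X0; [exact: h|exact: uX].
have : W (t g) ((X - X0) *m dmap t g).
  by apply: src_tangent_anchor; rewrite mulmxBl; exact: XX.
rewrite mulmxBl => XX'; rewrite /coset /=.
by rewrite -(subrKA (X *m dmap t g)); exact: addmx_sub uX XX'.
Qed.

Lemma normal_rep_isometry (H : M -> 'M[R]_n) : zero_metric GG H ->
  forall (g : G) (e e' : normal_bundle GG), s g = qbase e -> s g = qbase e' ->
  quot_metric H (normal_rep g e) (normal_rep g e') = quot_metric H e e'.
Proof.
move=> [_ Hiso] g e e' ge ge'.
have := Hiso (s g) g (gorbit_src g) (gorbit_tgt g).
have [v ev] := quot_qpt e; have [w ew] := quot_qpt e'.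
move=> /(_ v w); rewrite ev ew -ge -ge'.
have [e1 e2] := normal_rep_orbitwise v (gorbit_src g) (gorbit_tgt g).
have [e3 e4] := normal_rep_orbitwise w (gorbit_src g) (gorbit_tgt g).
rewrite -e2 -e4 e1 e3.
by rewrite (orbit_tangentE (gorbit_tgt g)) (orbit_tangentE (gorbit_src g)).
Qed.

End NormalRepresentation.

(** * A smooth frame of the image of the anchor *)

Section SmoothInverses.
Context (R : realType).

(** Fixing a right inverse B at x, the square matrix Z B is invertible nearby, and
    B (Z B)^-1 is a right inverse. *)
Lemma smooth_right_inverse (V : normedModType R) p n (Z : V -> 'M[R]_(p, n)) x :
  smooth_at Z x -> row_free (Z x) ->
  exists Q : V -> 'M[R]_(n, p), smooth_at Q x /\
    \forall y \near x, Z y *m Q y = 1%:M.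
Proof.
move=> sZ /row_freeP[B ZB].
have sZB : smooth_at (fun y => Z y *m B) x.
  exact: smooth_at_mulmx sZ (smooth_at_cst B x).
have uZB : Z x *m B \in unitmx by rewrite ZB unitmx1.
exists (fun y => B *m invmx (Z y *m B)); split.
  apply: smooth_at_mulmx; first exact: smooth_at_cst.
  exact: (@smooth_at_invmx _ _ _ (fun y => Z y *m B)).
by apply: filterS (unitmx_near sZB uZB) => y uy; rewrite mulmxA mulmxV.
Qed.

Lemma smooth_left_inverse (V : normedModType R) p n (Z : V -> 'M[R]_(p, n)) x :
  smooth_at Z x -> row_full (Z x) ->
  exists L : V -> 'M[R]_(n, p), smooth_at L x /\
    \forall y \near x, L y *m Z y = 1%:M.
Proof.
move=> sZ /row_fullP[B BZ].
have sBZ : smooth_at (fun y => B *m Z y) x.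
  exact: smooth_at_mulmx (smooth_at_cst B x) sZ.
have uBZ : B *m Z x \in unitmx by rewrite BZ unitmx1.
exists (fun y => invmx (B *m Z y) *m B); split.
  apply: smooth_at_mulmx; last exact: smooth_at_cst.
  exact: (@smooth_at_invmx _ _ _ (fun y => B *m Z y)).
by apply: filterS (unitmx_near sBZ uBZ) => y uy; rewrite -mulmxA mulVmx.
Qed.

Lemma row_free_near (V : normedModType R) p n (Z : V -> 'M[R]_(p, n)) x :
  smooth_at Z x -> row_free (Z x) -> \forall y \near x, row_free (Z y).
Proof.
move=> sZ fZ; have [Q [_ ZQ]] := smooth_right_inverse sZ fZ.
by apply: filterS ZQ => y ZQ; apply/row_freeP; exists (Q y).
Qed.

End SmoothInverses.

Section AnchorFrame.
Context (R : realType) (n k : nat) (M : manifold R n) (G : manifold R k).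
Context (GG : lie_groupoid M G).
Local Notation s := (src GG).
Local Notation t := (tgt GG).
Local Notation W := (im_anchor GG).
Local Notation u := (gunit GG).

(** The spanning matrix is (1 - S L) T, where S and T are the Jacobians of s and t
    along the units and L is a smooth left inverse of S: the rows of 1 - S L span
    the kernel of S. *)
Lemma anchor_in_chart (c : chart R M n) (x0 : M) : matlas c -> cdom c x0 ->
  exists B : 'rV[R]_n -> 'M[R]_(k, n), smooth_at B (c x0) /\
    \forall y \near c x0, forall v : 'rV[R]_n,
      W (cinv c y) v <-> (v *m dchart c (cinv c y) <= B y)%MS.
Proof.
move=> Ac cx0.
have [b [_ Ab bx0]] := chart_atP (u x0).
have csx : cdom c (s (u x0)) by rewrite src_unit.
have ctx : cdom c (t (u x0)) by rewrite tgt_unit.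
have su : smooth u := @smooth_unit _ _ _ _ _ GG.
have ss : smooth s := @smooth_src _ _ _ _ _ GG.
have st : smooth t := @smooth_tgt _ _ _ _ _ GG.
have [suc nu] := smooth_in_charts su Ac Ab cx0 bx0.
have uE : in_charts c b u (c x0) = b (u x0) := in_chartsE b u cx0.
have along (J : G -> 'M[R]_(k, n)) : smooth_at (fun z => J (cinv b z)) (b (u x0)) ->
    smooth_at (fun y => J (u (cinv c y))) (c x0).
  rewrite -uE => sJ; apply: smooth_at_eq (smooth_at_comp suc sJ).
  by apply: filterS nu => y [_ by_]; rewrite /in_charts cmapK.
have sS := along _ (smooth_jac_in ss Ab Ac bx0 csx).
have sT := along _ (smooth_jac_in st Ab Ac bx0 ctx).
set S := (fun y => jac_in b c s _) in sS; set T := (fun y => jac_in b c t _) in sT.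
have SE x : cdom c x -> cdom b (u x) ->
    dchart b (u x) *m jac_in b c s (u x) = dmap s (u x) *m dchart c x.
  move=> cx bx; have csx' : cdom c (s (u x)) by rewrite src_unit.
  by rewrite (dchart_jac ss Ab Ac bx csx') src_unit.
have TE x : cdom c x -> cdom b (u x) ->
    dchart b (u x) *m jac_in b c t (u x) = dmap t (u x) *m dchart c x.
  move=> cx bx; have ctx' : cdom c (t (u x)) by rewrite tgt_unit.
  by rewrite (dchart_jac st Ab Ac bx ctx') tgt_unit.
have fS : row_full (S (c x0)).
  rewrite /S cmapK //; have /row_fullP[L LS] := dsrc_full GG (u x0).
  have uc := dchart_unit Ac cx0.
  apply/row_fullP; exists (invmx (dchart c x0) *m L *m dchart b (u x0)).
  by rewrite -!mulmxA SE // (mulmxA L) LS mul1mx mulVmx.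
have [L [sL LS]] := smooth_left_inverse sS fS.
exists (fun y => (1%:M - S y *m L y) *m T y); split.
  apply: smooth_at_mulmx sT; apply: smooth_atB (smooth_at_cst _ _) _.
  exact: smooth_at_mulmx.
apply: filterS2 nu LS => y [cy by_] LSy v.
have cx := cdom_cinv cy; set x := cinv c y in cx by_ *.
have ub := dchart_unit Ab by_; have uc := dchart_unit Ac cx.
have SEy := SE x cx by_; have TEy := TE x cx by_.
rewrite -/(S y) in SEy; rewrite -/(T y) in TEy.
split=> [/im_anchorP[X X0 ->]|/submxP[D vD]].
  have XS : X *m dchart b (u x) *m S y = 0 by rewrite -mulmxA SEy mulmxA X0 mul0mx.
  apply/submxP; exists (X *m dchart b (u x)).
  rewrite mulmxA mulmxBr mulmx1 mulmxA XS mul0mx subr0.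
  by rewrite -!mulmxA TEy.
apply/im_anchorP; exists (D *m (1%:M - S y *m L y) *m invmx (dchart b (u x))).
  apply: (can_inj (mulmxK uc)); rewrite mul0mx -(mulmxA _ (dmap s (u x))) -SEy mulmxA mulmxKV //.
  by rewrite -(mulmxA D) mulmxBl mul1mx -(mulmxA (S y)) LSy mulmx1 subrr mulmx0.
apply: (can_inj (mulmxK uc)); rewrite -(mulmxA _ (dmap t (u x))) -TEy mulmxA mulmxKV //.
by rewrite vD mulmxA.
Qed.

(** The combinations of the rows of the spanning matrix B that form a basis at x0
    stay independent nearby; they still span there because regularity keeps the
    rank of B constant. *)
Lemma anchor_frame (c : chart R M n) (x0 : M) : regular GG ->
  matlas c -> cdom c x0 ->
  exists r (w : 'rV[R]_n -> 'M[R]_(r, n)), smooth_at w (c x0) /\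
    \forall y \near c x0, row_free (w y) /\ forall v : 'rV[R]_n,
      W (cinv c y) v <-> (v *m dchart c (cinv c y) <= w y)%MS.
Proof.
move=> reg Ac cx0; have [B [sB BE]] := anchor_in_chart Ac cx0.
pose E := row_base (B (c x0)) *m pinvmx (B (c x0)).
have EB : E *m B (c x0) = row_base (B (c x0)).
  by rewrite mulmxKpV // eq_row_base.
have sw : smooth_at (fun y => E *m B y) (c x0).
  exact: smooth_at_mulmx (smooth_at_cst _ _) sB.
have fw : row_free (E *m B (c x0)) by rewrite EB row_base_free.
exists _, (fun y => E *m B y); split; first exact: sw.
have rankB : \forall y \near c x0, \rank (B y) = \rank (anchor GG (cinv c y)).
  apply: filterS2 (cimg_near cx0) BE => y cy By.
  have uc := dchart_unit Ac (cdom_cinv cy).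
  rewrite -(mxrankMfree (anchor GG (cinv c y)) (_ : row_free (dchart c (cinv c y)))).
    apply/eqP; rewrite eqn_leq; apply/andP; split; apply: mxrankS.
      apply/row_subP => i; rewrite -(mulmxKV uc (row i (B y))).
      by rewrite submxMr //; apply/By; rewrite mulmxKV // row_sub.
    apply/row_subP => i; rewrite row_mul; apply/By.
    exact: row_sub.
  by rewrite row_free_unit.
have reg0 := near_cinv Ac cx0 (reg x0).
have rank0 : \rank (B (c x0)) = \rank (anchor GG x0).
  by have := nbhs_singleton rankB; rewrite cmapK.
have fwn := row_free_near sw fw.
apply: filterS3 (filterI fwn rankB) reg0 BE => y [fwy rB] rA By.
split; [exact: fwy|move=> v].
have wB : (E *m B y :=: B y)%MS.
  apply/eqmxP; rewrite -(geq_leqif (mxrank_leqif_eq (submxMl E (B y)))).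
  by move: fwy; rewrite /row_free => /eqP ->; rewrite rB rA rank0.
by rewrite wB; exact: By.
Qed.

End AnchorFrame.

(** * Charts of a quotient bundle *)

Definition smooth_subbundle (R : realType) n (M : manifold R n)
    (W : M -> set 'rV[R]_n) : Prop :=
  forall (c : chart R M n) x, matlas c -> cdom c x ->
  exists r (w : 'rV[R]_n -> 'M[R]_(r, n)), smooth_at w (c x) /\
    \forall y \near c x, row_free (w y) /\ forall v : 'rV[R]_n,
      W (cinv c y) v <-> (v *m dchart c (cinv c y) <= w y)%MS.

Section QuotientCharts.
Context (R : realType) (n : nat) (M : manifold R n) (W : M -> set 'rV[R]_n).
Hypothesis Wsub : smooth_subbundle W.

Lemma subbundle_submx x : exists r (A : 'M[R]_(r, n)) (P : 'M[R]_n),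
  forall v : 'rV[R]_n, W x v <-> (v *m P <= A)%MS.
Proof.
have [c [_ Ac cx]] := chart_atP x; have [r [w [_ wP]]] := Wsub Ac cx.
have [_ wx] := nbhs_singleton wP; rewrite cmapK // in wx.
by exists r, (w (c x)), (dchart c x).
Qed.

Lemma subbundle0 x : W x 0.
Proof. by have [r [A [P WP]]] := subbundle_submx x; apply/WP; rewrite mul0mx sub0mx. Qed.

Lemma subbundleB x (a b : 'rV[R]_n) : W x a -> W x b -> W x (a - b).
Proof.
have [r [A [P WP]]] := subbundle_submx x; move=> /WP Wa /WP Wb.
by apply/WP; rewrite mulmxBl; apply: addmx_sub => //; rewrite eqmx_opp.
Qed.

Lemma open_chart_image (c : chart R M n) U :
  matlas c -> open U -> U `<=` cdom c -> open (c @` U).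
Proof.
move=> Ac oU Uc; rewrite openE => _ [x Ux <-].
have nU := near_cinv Ac (Uc _ Ux) (open_nbhs_nbhs (conj oU Ux)).
rewrite /interior; apply: filterS2 (cimg_near (Uc _ Ux)) nU => y cy Uy.
by exists (cinv c y) => //; exact: cinvK.
Qed.

(** The condition on one bundle chart in [quot_charts], with its data made explicit. *)
Definition quot_chart_of q (c : chart R M n) (U : set M) (e : M -> 'M[R]_(q, n))
    (D : chart R (quot_bundle W) (n + q)) : Prop :=
  [/\ matlas c, open U /\ U `<=` cdom c, quot_frame W c U e &
      cdom D = @qbase _ _ _ W @^-1` U /\
      (forall z, U (qbase z) ->
         lsubmx (D z) = c (qbase z) /\
         qclass z = coset (W (qbase z)) (rsubmx (D z) *m e (qbase z)))].

Section OneFrame.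
Context (q : nat) (c : chart R M n) (U : set M) (e : M -> 'M[R]_(q, n)).
Context (Ac : matlas c) (oU : open U) (Uc : U `<=` cdom c).
Context (eP : quot_frame W c U e).

Lemma frame_coord_unique x (v : 'rV[R]_n) (a b : 'rV[R]_q) : U x ->
  W x (v - a *m e x) -> W x (v - b *m e x) -> a = b.
Proof.
move=> Ux va vb; have [_ /(_ x Ux v)[d [_ dU]]] := eP.
by rewrite -(dU _ va) -(dU _ vb).
Qed.

Lemma frame_smooth x : U x ->
  smooth_at (fun y => e (cinv c y) *m dchart c (cinv c y)) (c x).
Proof.
move=> Ux; have [Ce _] := eP.
rewrite dchart.unlock; apply: (Cinf_smooth_at (open_chart_image Ac oU Uc)) => //.
Qed.

(** Together with a frame of W, the frame of the quotient spans the tangent space.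
    The matrix K is the block of a smooth right inverse of these rows that reads
    off the coordinates in the frame of the quotient. *)
Lemma frame_coord x : U x -> exists K : 'rV[R]_n -> 'M[R]_(n, q),
  smooth_at K (c x) /\ \forall y \near c x, forall v : 'rV[R]_n,
    W (cinv c y) (v - v *m dchart c (cinv c y) *m K y *m e (cinv c y)).
Proof.
move=> Ux; have cx := Uc Ux; have [r [w [sw wP]]] := Wsub Ac cx.
have se := frame_smooth Ux; set ec := (fun y => _) in se.
have sZ : smooth_at (fun y => col_mx (w y) (ec y)) (c x) by exact: smooth_at_col_mx.
have fZ : row_free (col_mx (w (c x)) (ec (c x))).
  have [fw wx] := nbhs_singleton wP.
  rewrite -kermx_eq0; apply/rowV0P => v /sub_kermxP.
  rewrite -[v]hsubmxK mul_row_col; set b := lsubmx v; set a := rsubmx v => ba0.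
  have Wa : W x (0 - a *m e x).
    rewrite cmapK // in wx; apply/wx; rewrite sub0r mulNmx.
    apply/submxP; exists b; apply/eqP; rewrite eq_sym -addr_eq0; apply/eqP.
    by rewrite /ec cmapK // mulmxA in ba0.
  have W00 : W x (0 - 0 *m e x) by rewrite mul0mx subr0; exact: subbundle0.
  have a0 := frame_coord_unique Ux Wa W00.
  move: ba0; rewrite a0 mul0mx addr0 => b0.
  have -> : b = 0 by apply: (row_free_inj fw); rewrite b0 mul0mx.
  exact: row_mx0.
have [Q [sQ ZQ]] := smooth_right_inverse sZ fZ.
exists (fun y => rsubmx (Q y)); split; first exact: smooth_at_rsubmx.
have nU := near_cinv Ac cx (open_nbhs_nbhs (conj oU Ux)).
apply: filterS3 wP ZQ nU => y [_ wy] ZQy Uy v.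
have [_ /(_ _ Uy v)[a [Wa _]]] := eP.
suff -> : v *m dchart c (cinv c y) *m rsubmx (Q y) = a by [].
have /submxP[b vb] := (wy _).1 Wa; rewrite mulmxBl -mulmxA in vb.
have -> : v *m dchart c (cinv c y) = row_mx b a *m col_mx (w y) (ec y).
  by rewrite mul_row_col -vb subrK.
by rewrite -mulmxA mulmx_rsub ZQy mulmx_rsub mulmx1 row_mxKr.
Qed.

Context (D : chart R (quot_bundle W) (n + q)) (DP : quot_chart_of c U e D).

Lemma quot_chart_dom z : cdom D z <-> U (qbase z).
Proof. by have [_ _ _ [-> _]] := DP. Qed.

Lemma quot_chartE x (v : 'rV[R]_n) (a : 'rV[R]_q) : U x ->
  W x (v - a *m e x) -> D (qpt W x v) = row_mx (c x) a.
Proof.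
move=> Ux va; have [_ _ _ [_ /(_ (qpt W x v) Ux)[/= Dl Dr]]] := DP.
have Wv : W x (v - rsubmx (D (qpt W x v)) *m e x).
  by apply/(coset_eqP _ _ (subbundle0 x) (@subbundleB x)).
by rewrite -[LHS]hsubmxK Dl (frame_coord_unique Ux Wv va).
Qed.

Lemma quot_chart_frame x (a : 'rV[R]_q) : U x ->
  D (qpt W x (a *m e x)) = row_mx (c x) a.
Proof. by move=> Ux; apply: quot_chartE => //; rewrite subrr; exact: subbundle0. Qed.

Lemma quot_chart_inv y : (c @` U) (lsubmx y) ->
  let x := cinv c (lsubmx y) in
  U x /\ cinv D y = qpt W x (rsubmx y *m e x).
Proof.
move=> [x Ux cxy] /=; rewrite -cxy cmapK; last exact: Uc.
split=> //; rewrite -[y in cinv D y]hsubmxK -cxy -quot_chart_frame // cmapK //.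
exact/quot_chart_dom.
Qed.

Lemma quot_chart_image (V : set M) : V `<=` U ->
  D @` (@qbase _ _ _ W @^-1` V) = lsubmx @^-1` (c @` V).
Proof.
move=> VU; apply/seteqP; split=> [_ [z Vz <-]|y [x Vx xy]].
  have [_ _ _ [_ /(_ z (VU _ Vz))[Dl _]]] := DP.
  by exists (qbase z).
exists (qpt W x (rsubmx y *m e x)) => //.
by rewrite quot_chart_frame ?xy ?hsubmxK //; exact: VU.
Qed.

End OneFrame.

End QuotientCharts.

Section QuotientAtlas.
Context (R : realType) (n : nat) (M : manifold R n) (W : M -> set 'rV[R]_n).
Hypothesis Wsub : smooth_subbundle W.

Lemma open_lsub p q (O : set 'rV[R]_p) :
  open O -> open ((fun y : 'rV[R]_(p + q) => lsubmx y) @^-1` O).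
Proof. by move=> oO; apply: open_comp => // y _; exact: continuous_lsubmx. Qed.

(** The chart sends the class of a e(x) at x to (c x, a), and its image is the
    product of an open set with the space of coordinate rows. *)
Lemma chart_of_frame q (c : chart R M n) U (e : M -> 'M[R]_(q, n)) :
  matlas c -> open U -> U `<=` cdom c -> quot_frame W c U e ->
  exists D : chart R (quot_bundle W) (n + q), quot_chart_of c U e D.
Proof.
move=> Ac oU Uc eP.
pose a (z : quot_bundle W) :=
  xget 0 [set a | qclass z = coset (W (qbase z)) (a *m e (qbase z))].
have aP z : U (qbase z) -> qclass z = coset (W (qbase z)) (a z *m e (qbase z)).
  move=> Uz; have [v zv] := qclassP z.
  have [_ /(_ _ Uz v)[b [Wb _]]] := eP.
  have bz : [set a | qclass z = coset (W (qbase z)) (a *m e (qbase z))] b.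
    rewrite /= zv; apply/coset_eqP; [exact: subbundle0|exact: subbundleB|exact: Wb].
  exact: (xgetPex 0 (ex_intro _ b bz)).
have aE x (b : 'rV[R]_q) : U x -> a (qpt W x (b *m e x)) = b.
  move=> Ux; have /= /esym ab := aP (qpt W x (b *m e x)) Ux.
  have Wb : W x (b *m e x - b *m e x) by rewrite subrr; exact: subbundle0.
  apply: (frame_coord_unique eP Ux _ Wb).
  by apply/(coset_eqP _ _ (subbundle0 Wsub x) (@subbundleB _ _ _ _ Wsub x)).
pose pdom := @qbase _ _ _ W @^-1` U.
pose pmap z : 'rV[R]_(n + q) := row_mx (c (qbase z)) (a z).
pose pinv (y : 'rV[R]_(n + q)) :=
  qpt W (cinv c (lsubmx y)) (rsubmx y *m e (cinv c (lsubmx y))).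
have pmapK z : pdom z -> pinv (pmap z) = z.
  move=> Uz; rewrite /pinv /pmap row_mxKl row_mxKr cmapK; last exact: Uc.
  by apply: quot_ext => //=; rewrite -aP.
have pimg_open : open (pmap @` pdom).
  suff -> : pmap @` pdom = (fun y => lsubmx y) @^-1` (c @` U).
    exact/open_lsub/open_chart_image.
  apply/seteqP; split=> [_ [z Uz <-]|y [x Ux xy]].
    by rewrite /= /pmap row_mxKl; exists (qbase z).
  exists (qpt W x (rsubmx y *m e x)); first exact: Ux.
  by rewrite /pmap aE //= xy hsubmxK.
exists (Chart pmapK pimg_open); split=> //; split=> //= z Uz.
by rewrite /pmap row_mxKl row_mxKr; split=> //; exact: aP.
Qed.

(** In a chart, a complement of W at x0 is kept constant.  The rows of W and of the
    complement have a right and a left inverse nearby, hence stay independent and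
    spanning there. *)
Lemma adapted_frame x0 : exists q (c : chart R M n) U (e : M -> 'M[R]_(q, n)),
  [/\ matlas c, open U, U `<=` cdom c, U x0 & quot_frame W c U e].
Proof.
have [c [_ Ac cx0]] := chart_atP x0; have [r [w [sw wP]]] := Wsub Ac cx0.
have [fw0 _] := nbhs_singleton wP.
pose E := row_base (w (c x0))^C%MS.
have sZ : smooth_at (fun y => col_mx (w y) E) (c x0).
  by apply: smooth_at_col_mx => //; exact: smooth_at_cst.
have ZE : (col_mx (w (c x0)) E :=: w (c x0) + (w (c x0))^C)%MS.
  apply: eqmx_trans (eqmx_sym (addsmxE _ _)) _.
  by apply: adds_eqmx => //; exact: eq_row_base.
have fullZ : row_full (col_mx (w (c x0)) E).
  by rewrite /row_full ZE; exact: addsmx_compl_full.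
have freeZ : row_free (col_mx (w (c x0)) E).
  rewrite /row_free ZE mxrank_disjoint_sum ?capmx_compl //.
  by move: fw0; rewrite /row_free => /eqP ->.
have [Q [_ ZQ]] := smooth_right_inverse sZ freeZ.
have [L [_ LZ]] := smooth_left_inverse sZ fullZ.
have : \forall y \near c x0, [/\ row_free (w y), forall v : 'rV[R]_n,
    W (cinv c y) v <-> (v *m dchart c (cinv c y) <= w y)%MS,
    col_mx (w y) E *m Q y = 1%:M & L y *m col_mx (w y) E = 1%:M].
  by apply: filterS3 wP ZQ LZ => y [].
rewrite /prop_near1 nbhsE => -[N [oN Nx0] NP].
pose U := [set x | cdom c x /\ N (c x)].
have oU : open U.
  rewrite openE => x [cx Nx]; rewrite /interior.
  apply: filterI; first exact: cdom_near.
  exact: near_chart (open_nbhs_nbhs (conj oN Nx)).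
have Uc : U `<=` cdom c by move=> x [].
exists _, c, U, (fun x => E *m invmx (dchart c x)); split=> //.
split=> [j|x [cx Nx] v].
  have oc := open_chart_image Ac oU Uc.
  apply: (@Ck_eq _ _ _ _ _ (fun=> E)) => //; last exact: Ck_cst.
  move=> _ [x [cx _] <-]; rewrite cmapK //.
  move: (dchart_unit Ac cx); rewrite dchart.unlock => ux.
  by rewrite mulmxKV.
have [_ wx ZQx LZx] := NP _ Nx.
rewrite cmapK // in wx.
have ux := dchart_unit Ac cx.
have Wfr a : W x (v - a *m (E *m invmx (dchart c x))) <->
    (v *m dchart c x - a *m E <= w (c x))%MS.
  by apply: (iff_trans (wx _)); rewrite mulmxBl mulmxA mulmxKV.
pose b := v *m dchart c x *m L (c x).
have vE : v *m dchart c x = lsubmx b *m w (c x) + rsubmx b *m E.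
  by rewrite -mul_row_col hsubmxK /b -mulmxA LZx mulmx1.
exists (rsubmx b); split; first by apply/Wfr; rewrite vE addrK submxMl.
move=> a /Wfr; rewrite vE -addrA -mulmxBl => va.
have /submxP[d dE] : ((rsubmx b - a) *m E <= w (c x))%MS.
  rewrite -(addKr (lsubmx b *m w (c x)) ((rsubmx b - a) *m E)).
  by apply: addmx_sub => //; rewrite eqmx_opp submxMl.
apply/subr0_eq.
have Z0 : row_mx (- d) (rsubmx b - a) *m col_mx (w (c x)) E = 0.
  by rewrite mul_row_col mulNmx dE addNr.
have := congr1 (mulmx^~ (Q (c x))) Z0; rewrite -mulmxA ZQx mulmx1 mul0mx.
by move/(congr1 rsubmx); rewrite row_mxKr linear0.
Qed.

(** Over the change of base coordinates, a coordinate row is multiplied by the frame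
    e1, the Jacobian of the change of coordinates and the matrix K of the frame
    e2. *)
Lemma quot_transition q1 (c1 : chart R M n) U1 (e1 : M -> 'M[R]_(q1, n)) D1
    q2 (c2 : chart R M n) U2 (e2 : M -> 'M[R]_(q2, n)) D2 :
  quot_chart_of (W := W) c1 U1 e1 D1 -> quot_chart_of (W := W) c2 U2 e2 D2 ->
  let O := D1 @` (cdom D1 `&` cdom D2) in
  open O /\ Cinf O (fun y => D2 (cinv D1 y)).
Proof.
move=> DP1 DP2; have [Ac1 [oU1 Uc1] eP1 [domE1 _]] := DP1.
have [Ac2 [oU2 Uc2] eP2 [domE2 _]] := DP2.
have VU1 : U1 `&` U2 `<=` U1 by move=> x [].
have -> : cdom D1 `&` cdom D2 = @qbase _ _ _ W @^-1` (U1 `&` U2).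
  by rewrite domE1 domE2.
rewrite (quot_chart_image Wsub eP1 DP1 VU1) => O.
have oc1V : open (c1 @` (U1 `&` U2)).
  by apply: open_chart_image => //; [exact: openI|exact: subset_trans VU1 Uc1].
have oO : open O by exact: open_lsub.
split=> //; apply: smooth_at_Cinf => y0 Oy0; have [x0 [U1x0 U2x0] cx0] := Oy0.
have cx1 := Uc1 _ U1x0; have cx2 := Uc2 _ U2x0.
have [K [sK KP]] := frame_coord Wsub Ac2 oU2 Uc2 eP2 U2x0.
have sid := @smooth_id R n M.
have [sc _] := smooth_in_charts sid Ac1 Ac2 cx1 (cx2 : cdom c2 (id x0)).
have sJ := smooth_jac_in sid Ac1 Ac2 cx1 (cx2 : cdom c2 (id x0)).
have se := frame_smooth Ac1 oU1 Uc1 eP1 U1x0.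
have scK : smooth_at (fun y => K (in_charts c1 c2 id y)) (c1 x0).
  by apply: smooth_at_comp => //; rewrite in_chartsE.
pose B y := e1 (cinv c1 y) *m dchart c1 (cinv c1 y) *m
  jac_in c1 c2 id (cinv c1 y) *m K (in_charts c1 c2 id y).
have sB : smooth_at B (c1 x0).
  by apply: smooth_at_mulmx => //; exact: smooth_at_mulmx.
have sl : smooth_at (fun y : 'rV[R]_(n + q1) => lsubmx y) y0.
  exact: smooth_at_lsubmx (smooth_at_id y0).
have sr : smooth_at (fun y : 'rV[R]_(n + q1) => rsubmx y) y0.
  exact: smooth_at_rsubmx (smooth_at_id y0).
have sBl : smooth_at (fun y : 'rV[R]_(n + q1) => B (lsubmx y)) y0.
  by apply: smooth_at_comp => //; rewrite -cx0.
have scl : smooth_at (fun y : 'rV[R]_(n + q1) => in_charts c1 c2 id (lsubmx y)) y0.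
  by apply: smooth_at_comp => //; rewrite -cx0.
apply: smooth_at_eq (smooth_at_row_mx scl (smooth_at_mulmx sr sBl)).
have KP' : \forall y \near y0, forall v : 'rV[R]_n,
    let x := cinv c2 (in_charts c1 c2 id (lsubmx y)) in
    W x (v - v *m dchart c2 x *m K (in_charts c1 c2 id (lsubmx y)) *m e2 x).
  have N2 : nbhs (in_charts c1 c2 id (lsubmx y0)) (fun z => forall v : 'rV[R]_n,
      W (cinv c2 z) (v - v *m dchart c2 (cinv c2 z) *m K z *m e2 (cinv c2 z))).
    by rewrite -cx0 in_chartsE.
  exact: (smooth_at_continuous scl N2).
apply: filterS2 (open_nbhs_nbhs (conj oO Oy0)) KP' => y Oy KPy.
have [x [U1x U2x] cx] := Oy.
have cix : cinv c1 (lsubmx y) = x by rewrite -cx cmapK //; exact: Uc1.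
have [_ ->] := quot_chart_inv Wsub Uc1 eP1 DP1 (ex_intro2 _ _ x U1x cx).
rewrite cix; apply: esym.
have icE : in_charts c1 c2 id (lsubmx y) = c2 x by rewrite /in_charts cix.
rewrite icE in KPy *; move: KPy; rewrite /= cmapK; last exact: Uc2.
move=> KPy; rewrite (quot_chartE Wsub eP2 DP2 U2x (KPy _)).
rewrite /B cix icE; congr (row_mx _ _).
by rewrite -(dchart_trans Ac1 Ac2 (Uc1 _ U1x) (Uc2 _ U2x)) !mulmxA.
Qed.

Lemma quot_chartsP (C : {p & chart R (quot_bundle W) p}) : quot_charts W C <->
  exists q (c : chart R M n) U (e : M -> 'M[R]_(q, n)) D,
    quot_chart_of c U e D /\ C = existT _ (n + q)%N D.
Proof.
split=> [[q [c [U [e [D [Ac oU eP spec E]]]]]]|[q [c [U [e [D [[Ac oU eP spec] E]]]]]]];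
  by exists q, c, U, e, D.
Qed.

Lemma quot_charts_atlas : is_atlas (quot_charts W).
Proof.
split=> [z|m C1 p C2].
  have [q [c [U [e [Ac oU Uc Ux eP]]]]] := adapted_frame (qbase z).
  have [D DP] := chart_of_frame Ac oU Uc eP.
  exists _, D; split; last exact/(quot_chart_dom DP).
  by apply/quot_chartsP; exists q, c, U, e, D.
pose P (C D : {p & chart R (quot_bundle W) p}) :=
  let O := projT2 C @` (cdom (projT2 C) `&` cdom (projT2 D)) in
  open O /\ Cinf O (fun y => projT2 D (cinv (projT2 C) y)).
suff PP C D : quot_charts W C -> quot_charts W D -> P C D.
  exact: (PP (existT _ m C1) (existT _ p C2)).
move=> /quot_chartsP[q1 [c1 [U1 [e1 [D1 [DP1 ->]]]]]].
move=> /quot_chartsP[q2 [c2 [U2 [e2 [D2 [DP2 ->]]]]]].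
exact: quot_transition DP1 DP2.
Qed.

End QuotientAtlas.

(** * Smoothness of the normal representation *)

Section SmoothRepresentation.
Context (R : realType) (n k : nat) (M : manifold R n) (G : manifold R k).
Context (GG : lie_groupoid M G).
Local Notation s := (src GG).
Local Notation t := (tgt GG).
Local Notation W := (im_anchor GG).

(** Charts are bundled with their dimensions, so that membership in an atlas can be
    destructed without transporting along equalities of dimensions. *)
Lemma smooth_onI (T S : Type) (A : charts R T) (B : charts R S) (D : set T)
    (f : T -> S) :
  (forall (C : {m & chart R T m}) (E : {p & chart R S p}) x,
     A C -> B E -> D x -> cdom (projT2 C) x -> cdom (projT2 E) (f x) ->
     exists F, smooth_at F (projT2 C x) /\ \forall y \near projT2 C x,
       forall z, cdom (projT2 C) z -> D z -> projT2 C z = y ->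
         cdom (projT2 E) (f z) /\ F y = projT2 E (f z)) ->
  smooth_on A B D f.
Proof.
move=> H m c p d x Ac Bd Dx cx dfx.
have [F [[U1 [oU1 U1x CF]] nF]] := H (existT _ m c) (existT _ p d) x Ac Bd Dx cx dfx.
move: nF; rewrite /prop_near1 nbhsE => -[U2 [oU2 U2x] FE].
exists (U1 `&` U2), F; split=> //; first exact: openI.
  by move=> j; apply: Ck_sub (CF j); exact: subIsetl.
by move=> z cz Dz [_ U2z]; exact: FE.
Qed.

Hypothesis reg : regular GG.

Lemma im_anchor_subbundle : smooth_subbundle W.
Proof. by move=> c x; exact: anchor_frame. Qed.

Let Wsub := im_anchor_subbundle.

(** With S and T the Jacobians of s and t and L a smooth left inverse of S, a
    coordinate row a is first turned into a tangent vector by e1, then lifted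
    along ds by L, mapped by T, and finally read in the frame e2 by its matrix K. *)
Lemma normal_rep_in_charts (c : chart R G k)
    q1 (c1 : chart R M n) U1 (e1 : M -> 'M[R]_(q1, n)) D1
    q2 (c2 : chart R M n) U2 (e2 : M -> 'M[R]_(q2, n)) D2 g0 e0 :
  matlas c -> quot_chart_of (W := W) c1 U1 e1 D1 ->
  quot_chart_of (W := W) c2 U2 e2 D2 ->
  s g0 = qbase e0 -> cdom c g0 -> U1 (qbase e0) -> U2 (t g0) ->
  exists F : 'rV[R]_(k + (n + q1)) -> 'rV[R]_(n + q2),
    smooth_at F (row_mx (c g0) (D1 e0)) /\
    \forall y \near row_mx (c g0) (D1 e0), forall g e,
      cdom c g -> U1 (qbase e) -> s g = qbase e -> row_mx (c g) (D1 e) = y ->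
      U2 (t g) /\ F y = D2 (normal_rep g e).
Proof.
move=> Ac DP1 DP2 ge0 cg0 U1e0 U2g0.
have [Ac1 [oU1 Uc1] eP1 [_ spec1]] := DP1.
have [Ac2 [oU2 Uc2] eP2 _] := DP2.
have U1g0 : U1 (s g0) by rewrite ge0.
have c1s := Uc1 _ U1g0; have c2t := Uc2 _ U2g0.
have ss : smooth s := @smooth_src _ _ _ _ _ GG.
have st : smooth t := @smooth_tgt _ _ _ _ _ GG.
have [sss _] := smooth_in_charts ss Ac Ac1 cg0 c1s.
have [sst _] := smooth_in_charts st Ac Ac2 cg0 c2t.
have sS := smooth_jac_in ss Ac Ac1 cg0 c1s.
have sT := smooth_jac_in st Ac Ac2 cg0 c2t.
set S := (fun y => jac_in c c1 s _) in sS.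
set T := (fun y => jac_in c c2 t _) in sT.
have SE g : cdom c g -> cdom c1 (s g) ->
    dchart c g *m S (c g) = dmap s g *m dchart c1 (s g).
  by move=> cg csg; rewrite /S cmapK // (dchart_jac ss Ac Ac1 cg csg).
have TE g : cdom c g -> cdom c2 (t g) ->
    dchart c g *m T (c g) = dmap t g *m dchart c2 (t g).
  by move=> cg ctg; rewrite /T cmapK // (dchart_jac st Ac Ac2 cg ctg).
have fS : row_full (S (c g0)).
  have /row_fullP[L LS] := dsrc_full GG g0.
  have u1 := dchart_unit Ac1 c1s.
  apply/row_fullP; exists (invmx (dchart c1 (s g0)) *m L *m dchart c g0).
  by rewrite -!mulmxA SE // (mulmxA L) LS mul1mx mulVmx.
have [L [sL LS]] := smooth_left_inverse sS fS.
have [K [sK KP]] := frame_coord Wsub Ac2 oU2 Uc2 eP2 U2g0.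
have se := frame_smooth Ac1 oU1 Uc1 eP1 U1g0.
set ec := (fun y => e1 _ *m _) in se.
have sec : smooth_at (fun y => ec (in_charts c c1 s y)) (c g0).
  by apply: smooth_at_comp => //; rewrite in_chartsE.
have scK : smooth_at (fun y => K (in_charts c c2 t y)) (c g0).
  by apply: smooth_at_comp => //; rewrite in_chartsE.
pose B y := ec (in_charts c c1 s y) *m L y *m T y *m K (in_charts c c2 t y).
have sB : smooth_at B (c g0).
  by do 2 (apply: smooth_at_mulmx => //); exact: smooth_at_mulmx.
pose y0 := row_mx (c g0) (D1 e0).
have ly0 : lsubmx y0 = c g0 by exact: row_mxKl.
have sl : smooth_at (fun y : 'rV[R]_(k + (n + q1)) => lsubmx y) y0.
  exact: smooth_at_lsubmx (smooth_at_id y0).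
have sr : smooth_at (fun y : 'rV[R]_(k + (n + q1)) => rsubmx (rsubmx y)) y0.
  by apply: smooth_at_rsubmx; exact: smooth_at_rsubmx (smooth_at_id y0).
have sBl : smooth_at (fun y : 'rV[R]_(k + (n + q1)) => B (lsubmx y)) y0.
  by apply: smooth_at_comp => //; rewrite ly0.
have stl : smooth_at (fun y : 'rV[R]_(k + (n + q1)) => in_charts c c2 t (lsubmx y)) y0.
  by apply: smooth_at_comp => //; rewrite ly0.
exists (fun y => row_mx (in_charts c c2 t (lsubmx y))
  (rsubmx (rsubmx y) *m B (lsubmx y))); split.
  exact: smooth_at_row_mx stl (smooth_at_mulmx sr sBl).
have nU2 : \forall y \near y0, U2 (t (cinv c (lsubmx y))).
  apply: (near_lsub (P := fun z => U2 (t (cinv c z)))); rewrite ly0.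
  exact: (smooth_near_cinv st Ac cg0 (open_nbhs_nbhs (conj oU2 U2g0))).
have nL : \forall y \near y0, L (lsubmx y) *m S (lsubmx y) = 1%:M.
  by apply: (near_lsub (P := fun z => L z *m S z = 1%:M)); rewrite ly0.
have nK : \forall y \near y0, forall v : 'rV[R]_n,
    let x := cinv c2 (in_charts c c2 t (lsubmx y)) in
    W x (v - v *m dchart c2 x *m K (in_charts c c2 t (lsubmx y)) *m e2 x).
  have N2 : nbhs (in_charts c c2 t (lsubmx y0)) (fun z => forall v : 'rV[R]_n,
      W (cinv c2 z) (v - v *m dchart c2 (cinv c2 z) *m K z *m e2 (cinv c2 z))).
    by rewrite ly0 in_chartsE.
  exact: (smooth_at_continuous stl N2).
apply: filterS3 nU2 nL nK => y U2y LSy Ky g e cg U1e ge yE.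
have lyE : lsubmx y = c g by rewrite -yE row_mxKl.
have ryE : rsubmx y = D1 e by rewrite -yE row_mxKr.
rewrite lyE cmapK // in U2y; split=> //.
have U1sg : U1 (s g) by rewrite ge.
have c1sg := Uc1 _ U1sg; have c2tg := Uc2 _ U2y.
have uc := dchart_unit Ac cg; have u1 := dchart_unit Ac1 c1sg.
pose a := rsubmx (D1 e).
have eE : e = qpt W (s g) (a *m e1 (s g)).
  have [_ De] := spec1 _ U1e; rewrite -ge in De.
  by apply: quot_ext; [exact: esym ge|exact: De].
pose X := a *m (e1 (s g) *m dchart c1 (s g)) *m L (c g) *m invmx (dchart c g).
have XS : X *m dmap s g = a *m e1 (s g).
  apply: (can_inj (mulmxK u1)).
  rewrite -(mulmxA X) -SE // /X mulmxA mulmxKV // -(mulmxA _ (L (c g))).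
  by move: LSy; rewrite lyE => ->; rewrite mulmx1 mulmxA.
rewrite eE -XS normal_repE.
have icE : in_charts c c2 t (c g) = c2 (t g) by rewrite in_chartsE.
move: (Ky (X *m dmap t g)); rewrite lyE icE /= cmapK // => WK.
rewrite (quot_chartE Wsub eP2 DP2 U2y WK) ryE -/a; congr (row_mx _ _).
rewrite -(mulmxA X) -TE // /B icE (in_chartsE c1 s cg) /ec cmapK //.
by rewrite /X !mulmxA mulmxKV.
Qed.

Lemma normal_rep_smooth :
  smooth_on (prod_charts (mcharts G) (quot_charts W)) (quot_charts W)
    (@action_dom _ _ _ _ _ GG W) (fun p => normal_rep p.1 p.2).
Proof.
pose pc (C1 : {m & chart R G m}) (C2 : {p & chart R (quot_bundle W) p}) :=
  existT (chart R (G * quot_bundle W)) _ (prod_chart (projT2 C1) (projT2 C2)).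
apply: smooth_onI => C E [g0 e0] [m [c' [p [D' [[c Ac ec] AD ->]]]]].
move: AD => /quot_chartsP[q1 [c1 [U1 [e1 [D1 [DP1 ED]]]]]].
move=> /quot_chartsP[q2 [c2 [U2 [e2 [D2 [DP2 ->]]]]]].
have -> : existT (chart R (G * quot_bundle W)) (m + p)%N (prod_chart c' D') =
  pc (existT _ k c) (existT _ (n + q1)%N D1) by rewrite ec -ED.
move=> ge0 [/= cg0 /(quot_chart_dom DP1) U1e0] /(quot_chart_dom DP2) U2g0.
have [F [sF FE]] := normal_rep_in_charts Ac DP1 DP2 ge0 cg0 U1e0 U2g0.
exists F; split=> //; apply: filterS FE => y FE [g e] [/= cg De] ge yE.
have U1e := (quot_chart_dom DP1 e).1 De.
have [U2g ->] := FE g e cg U1e ge yE.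
by split=> //; apply/(quot_chart_dom DP2).
Qed.

End SmoothRepresentation.

Theorem proposition3p11 (R : realType) (n k : nat)
    (M : manifold R n) (G : manifold R k) (GG : lie_groupoid M G)
    (hreg : regular GG) :
  is_atlas (quot_charts (im_anchor GG)) /\
  exists lam : G -> normal_bundle GG -> normal_bundle GG,
    (forall (x : M) (g : G) (v : 'rV[R]_n),
       gorbit GG x (src GG g) -> gorbit GG x (tgt GG g) ->
       coset (orbit_tangent GG x (src GG g)) v =
         qclass (qpt (im_anchor GG) (src GG g) v) /\
       qclass (lam g (qpt (im_anchor GG) (src GG g) v)) =
         orbit_normal_rep GG x g
           (coset (orbit_tangent GG x (src GG g)) v)) /\
    smooth_representation GG lam /\
    (forall (g : G) (e : normal_bundle GG),
       src GG g = qbase e -> qbase (lam g e) = tgt GG g) /\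
    (compact [set: M] -> connected [set: M] ->
     forall H : M -> 'M[R]_n, zero_metric GG H ->
     forall (g : G) (e e' : normal_bundle GG),
       src GG g = qbase e -> src GG g = qbase e' ->
       quot_metric H (lam g e) (lam g e') = quot_metric H e e').
Proof.
split; first exact/quot_charts_atlas/im_anchor_subbundle.
exists (@normal_rep _ _ _ _ _ GG); split; first exact: normal_rep_orbitwise.
split; first by split; [exact: normal_rep_representation|exact: normal_rep_smooth].
by split=> [//|_ _ H]; exact: normal_rep_isometry.
Qed.
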